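(* Let $d\ge1$, $\alpha\in(0,2)$, and let $V\in C^2(\mathbb R^d)$ be such that $\mu_V$ is a probability measure and $V\ge0$. If there exists a constant $\delta\in(0,1)$ such that $$\lim_{|x|\to\infty}\big\{\delta|\nabla V(x)|^2-\Delta V(x)\big\}=\infty,$$ then there exist constants $c_1,c_2>0$ such that the super Poincaré inequality $$\mu_V(f^2)\le r\,\mathscr E_{\alpha,V}(f,f)+\beta(r)\mu_V(|f|)^2,\quad r>0,\ f\in\mathscr D(\mathscr E_{\alpha,V}),$$ holds for $$\beta(r)=c_1\bigg(1+r^{-d/\alpha}H^{2+d/2}\Big(W_\delta^{-1}\big(c_2r^{-2/\alpha}\big)\Big)\,h^{-(1+d/2)}\Big(W_\delta^{-1}\big(c_2r^{-2/\alpha}\big)\Big)\bigg),\quad r>0.$$ In particular, if $V(x)=(1+|x|^2)^\varepsilon$ with $\varepsilon>\frac12$, then there exists a constant $c>0$ such that the super Poincaré inequality holds for $$\beta(r)=\exp\Big(c\big(1+r^{-2\varepsilon/(\alpha(2\varepsilon-1))}\big)\Big),\quad r>0.$$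
   Context: $\mu_V(dx):=\big(\int_{\mathbb R^d}e^{-V(y)}dy\big)^{-1}e^{-V(x)}dx$; $\mu_V(f):=\int f\,d\mu_V$. The Dirichlet form is $$\mathscr E_{\alpha,V}(f,g):=\iint_{\mathbb R^d\times\mathbb R^d}\frac{(f(x)-f(y))(g(x)-g(y))}{|x-y|^{d+\alpha}}\,dy\,\mu_V(dx),\qquad \mathscr D(\mathscr E_{\alpha,V}):=\{f\in L^2(\mu_V):\mathscr E_{\alpha,V}(f,f)<\infty\}.$$ For $r\ge0$: $h(r)=\inf_{|x|\le r}e^{V(x)}$, $H(r)=\sup_{|x|\le r}e^{V(x)}$, $W_\delta(r)=\inf_{|x|\ge r}\big(\delta|\nabla V(x)|^2-\Delta V(x)\big)$, and $W_\delta^{-1}(s)=\inf\{r\ge0:W_\delta(r)\ge s\}$. Here $H^{p}(r)$ and $h^{p}(r)$ mean $H(r)^p$ and $h(r)^p$. *)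

(* Defs.v *)
From HB Require Import structures.
From mathcomp Require Import all_boot all_order all_algebra.
From mathcomp Require Import all_classical all_reals all_analysis.
From mathcomp Require Import measurable_realfun.
Import Order.TTheory GRing.Theory Num.Theory.
Import numFieldNormedType.Exports.

Set Implicit Arguments.
Unset Strict Implicit.
Unset Printing Implicit Defensive.

Local Open Scope classical_set_scope.
Local Open Scope ring_scope.

Definition rV_display : measure_display -> measure_display.
Proof. exact. Qed.

(* The sigma-algebra on R^n is generated by the coordinates, as for
   [n.-tuple R] in the library: it is the Borel sigma-algebra. *)
Section measurable_rV.
Context (R : realType) (n : nat).

Let coord (i : 'I_n) (x : 'rV[R]_n) : R := x 0 i.

HB.instance Definition _ := @isMeasurable.Build
  (rV_display default_measure_display) 'rV[R]_n (g_sigma_preimage coord)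
  (@sigma_algebra0 _ _ _) (@sigma_algebraC _ _) (@sigma_algebra_bigcup _ _ _).

Lemma measurable_coord (i : 'I_n) :
  measurable_fun [set: 'rV[R]_n] (fun x => x 0 i).
Proof.
move=> _ Y mY; rewrite setTI; apply: sub_sigma_algebra => /=.
rewrite -bigcup_seq/=; exists i => /=; first by rewrite mem_index_enum.
by exists Y => //; rewrite setTI.
Qed.

Lemma measurable_fun_rV d (T : measurableType d) (f : T -> 'rV[R]_n) :
  (forall i, measurable_fun [set: T] (fun t => f t 0 i)) ->
  measurable_fun [set: T] f.
Proof.
move=> mf.
suff: g_sigma_preimage (fun i => coord i \o f) `<=` measurable.
  by rewrite g_sigma_preimage_comp => H _ A mA; apply: H; exists A.
apply: smallest_sub; first exact: sigma_algebra_measurable.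
move=> A; rewrite -bigcup_seq/= => -[i _ [B mB <-]].
exact: mf.
Qed.

End measurable_rV.

Section lebesgue_rV.
Context (R : realType).

Definition rV_cons n (p : R * 'rV[R]_n) : 'rV[R]_n.+1 :=
  \row_i oapp (fun j => p.2 0 j) p.1 (unlift ord0 i).

Fixpoint lebesgue_rV n : set 'rV[R]_n -> \bar R :=
  match n with
  | 0 => \d_(0 : 'rV[R]_0)
  | n'.+1 => pushforward (lebesgue_measure \x @lebesgue_rV n')%E (@rV_cons n')
  end.

Let rV_uncons n (x : 'rV[R]_n.+1) : R * 'rV[R]_n :=
  (x 0 ord0, \row_j x 0 (lift ord0 j)).

Let rV_consK n : cancel (@rV_cons n) (@rV_uncons n).
Proof.
move=> [a x]; rewrite /rV_uncons mxE unlift_none/=; congr (_, _).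
by apply/rowP => j; rewrite !mxE liftK.
Qed.

Let rV_unconsK n : cancel (@rV_uncons n) (@rV_cons n).
Proof.
move=> x; apply/rowP => i; rewrite mxE.
by case: unliftP => [j|] -> /=; rewrite ?mxE.
Qed.

Lemma measurable_rV_cons n : measurable_fun [set: R * 'rV[R]_n] (@rV_cons n).
Proof.
apply: measurable_fun_rV => i; under eq_fun do rewrite mxE.
case: unlift => [j|] /=; last exact: measurable_fst.
by apply: (measurableT_comp (@measurable_coord R n j)); exact: measurable_snd.
Qed.

Let measurable_rV_uncons n : measurable_fun [set: 'rV[R]_n.+1] (@rV_uncons n).
Proof.
apply/measurable_fun_pair => /=; first exact: measurable_coord.
apply: measurable_fun_rV => i; under eq_fun do rewrite mxE.
exact: measurable_coord.
Qed.

Let lebesgue_rV_subproof n :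
  exists m : {sigma_finite_measure set 'rV[R]_n -> \bar R}, @lebesgue_rV n = m.
Proof.
elim: n => [|n [m mE]] /=; first by exists (\d_(0 : 'rV[R]_0)).
rewrite mE.
pose l : {sigma_finite_measure set (measurableTypeR R) -> \bar R} :=
  @lebesgue_measure R.
pose lm := (l \x m)%E.
have mp : measurable_fun [set: measurableTypeR R * 'rV[R]_n] (@rV_cons n) :=
  @measurable_rV_cons n.
pose p := pushforward lm (@rV_cons n).
have p0 : p set0 = 0%E by rewrite /p /pushforward preimage_set0; exact: measure0.
have p_ge0 A : (0 <= p A)%E by exact: measure_ge0.
have p_add : semi_sigma_additive p.
  move=> F mF tF mUF; rewrite /p /pushforward preimage_bigcup.
  apply: measure_semi_sigma_additive.
  - by move=> k; rewrite -[X in measurable X]setTI; exact: mp.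
  - apply/trivIsetP => /= i j _ _ ij; rewrite -preimage_setI.
    by move/trivIsetP : tF => /(_ _ _ _ _ ij) ->//; rewrite preimage_set0.
  - by rewrite -preimage_bigcup -[X in measurable X]setTI; exact: mp.
have p_fin : sigma_finite setT p.
  have /sigma_finiteP[F [FT ndF Foo]] := sigma_finiteT l.
  have /sigma_finiteP[G [GT ndG Goo]] := sigma_finiteT m.
  exists (fun k => @rV_uncons n @^-1` (F k `*` G k)).
    rewrite -preimage_bigcup; apply/seteqP; split => // x _ /=.
    have [i _ Fi] : (\bigcup_i F i) (x 0 ord0) by rewrite -FT.
    have [j _ Gj] : (\bigcup_i G i) (@rV_uncons n x).2 by rewrite -GT.
    exists (maxn i j) => //; split => /=.
      by move: Fi; exact/subsetPset/ndF/leq_maxl.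
    by move: Gj; exact/subsetPset/ndG/leq_maxr.
  move=> k; have [mF Fk] := Foo k; have [mG Gk] := Goo k; split.
    rewrite -[X in measurable X]setTI.
    by apply: measurable_rV_uncons => //; exact: measurableX.
  rewrite /p /pushforward -comp_preimage (_ : _ \o _ = idfun) ?preimage_id; last first.
    by apply/funext => x; exact: rV_consK.
  by rewrite /lm product_measure1E// lte_mul_pinfty// ge0_fin_numE.
suff: exists m' : {sigma_finite_measure set 'rV[R]_n.+1 -> \bar R}, p = m' by [].
 clearbody p.
pose M := isMeasure.Build _ _ _ p p0 p_ge0 p_add.
pose N : {measure set 'rV[R]_n.+1 -> \bar R} := HB.pack p M.
pose SF := Measure_isSigmaFinite.Build _ _ _ N p_fin.
by exists (HB.pack_for {sigma_finite_measure set 'rV[R]_n.+1 -> \bar R} p M SF).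
Qed.

Section instances.
Context (n : nat).

Let lebesgue_rV0 : @lebesgue_rV n set0 = 0%E.
Proof. by have [m ->] := lebesgue_rV_subproof n. Qed.

Let lebesgue_rV_ge0 A : (0 <= @lebesgue_rV n A)%E.
Proof. by have [m ->] := lebesgue_rV_subproof n. Qed.

Let lebesgue_rV_sigma_additive : semi_sigma_additive (@lebesgue_rV n).
Proof.
have [m ->] := lebesgue_rV_subproof n; exact: measure_semi_sigma_additive.
Qed.

HB.instance Definition _ := isMeasure.Build _ _ _ (@lebesgue_rV n)
  lebesgue_rV0 lebesgue_rV_ge0 lebesgue_rV_sigma_additive.

Let lebesgue_rV_sigma_finite : sigma_finite setT (@lebesgue_rV n).
Proof. by have [m ->] := lebesgue_rV_subproof n; exact: sigma_finiteT. Qed.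

HB.instance Definition _ := Measure_isSigmaFinite.Build _ _ _ (@lebesgue_rV n)
  lebesgue_rV_sigma_finite.

End instances.

Lemma lebesgue_rV_prod n (A : 'I_n -> set R) :
  (forall i, measurable (A i)) ->
  lebesgue_rV [set x | forall i, A i (x 0 i)] =
  (\prod_(i < n) lebesgue_measure (A i))%E.
Proof.
elim: n A => [|n ih] A mA.
  rewrite big_ord0/= diracE mem_set//=; by case.
have mB : measurable [set x : 'rV[R]_n | forall i, A (lift ord0 i) (x 0 i)].
  rewrite [X in measurable X](_ : _ = \bigcap_(i in [set: 'I_n])
     ((fun x : 'rV[R]_n => x 0 i) @^-1` A (lift ord0 i))); last first.
    apply/seteqP; split => x /= h i; last exact: h.
    by move=> _; exact: h.
  apply: fin_bigcap_measurable => // i _.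
  by rewrite -[X in measurable X]setTI; exact: measurable_coord.
rewrite big_ord_recl -ih//= -product_measure1E//=.
rewrite /pushforward; congr ((_ \x _)%E _); apply/seteqP; split => -[a x] /= h.
    split; first by have := h ord0; rewrite mxE unlift_none.
    by move=> i; have := h (lift ord0 i); rewrite mxE liftK.
  move=> i; rewrite mxE; case: unliftP => [j|] -> /=; first exact: h.2.
  exact: h.1.
exact: (mA ord0).
Qed.

End lebesgue_rV.

Section calculus.
Context (R : realType) (d : nat).
Implicit Types (f V : 'rV[R]_d -> R) (x : 'rV[R]_d).

(* The norm [`|x|] of the library on ['rV[R]_d] is the sup norm. *)
Definition enorm x : R := Num.sqrt (\sum_(i < d) x 0 i ^+ 2).

Definition partial (i : 'I_d) f : 'rV[R]_d -> R := 'D_(delta_mx 0 i) f.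

Fixpoint Ck (k : nat) f : Prop :=
  continuous f /\
  match k with
  | 0 => True
  | k'.+1 => forall i : 'I_d,
      (forall x, derivable f x (delta_mx 0 i)) /\ Ck k' (partial i f)
  end.

Definition grad f x : 'rV[R]_d := \row_(i < d) partial i f x.

Definition laplacian f x : R := \sum_(i < d) partial i (partial i f) x.

End calculus.

Section super_poincare.
Context (R : realType) (d : nat).
Implicit Types (V f g : 'rV[R]_d -> R) (alpha delta r s : R).

(* When the integral of [expR (- V x)] is infinite, [fine] sends it to [0]
   and the result is the null measure, not a probability. *)
Definition gibbs V (A : set 'rV[R]_d) : \bar R :=
  ((fine (\int[@lebesgue_rV R d]_y (expR (- V y))%:E))^-1%:E *
   \int[@lebesgue_rV R d]_(x in A) (expR (- V x))%:E)%E.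

Lemma gibbs_probability V : measurable_fun [set: 'rV[R]_d] V ->
  gibbs V setT = 1%E -> exists P : probability 'rV[R]_d R, gibbs V = P.
Proof.
move=> mV gT; set p := gibbs V.
pose e (x : 'rV[R]_d) : R := expR (- V x).
have me : measurable_fun [set: 'rV[R]_d] (EFin \o e).
  apply/measurable_EFinP; apply: measurableT_comp => //; exact: measurableT_comp.
have e0 x : (0 <= (expR (- V x))%:E)%E by rewrite lee_fin expR_ge0.
have c0 : (0 <= (fine (\int[@lebesgue_rV R d]_y (expR (- V y))%:E))^-1)%R.
  by rewrite invr_ge0 fine_ge0// integral_ge0.
have p0 : p set0 = 0%E by rewrite /p /gibbs integral_set0 mule0.
have p_ge0 A : (0 <= p A)%E by rewrite /p /gibbs mule_ge0// integral_ge0.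
have p_add : semi_sigma_additive p.
  move=> F mF tF mUF; rewrite /p /gibbs ge0_integral_bigcup//=; last first.
    exact: measurable_funS me.
  rewrite -nneseriesZl//; last by move=> i _; exact: integral_ge0.
  apply: is_cvg_nneseries => n _ _; rewrite mule_ge0//; exact: integral_ge0.
have pT : p setT = 1%E by [].
clearbody p.
pose M := isMeasure.Build _ _ _ p p0 p_ge0 p_add.
pose N : {measure set 'rV[R]_d -> \bar R} := HB.pack p M.
pose SF := Measure_isProbability.Build _ _ _ N pT.
by exists (HB.pack_for (probability 'rV[R]_d R) p M SF).
Qed.

Definition dirichlet_form alpha V f g : \bar R :=
  (\int[gibbs V]_x \int[@lebesgue_rV R d]_y
    ((f x - f y) * (g x - g y) / enorm (x - y) `^ (d%:R + alpha))%:E)%E.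

Definition dirichlet_domain alpha V : set ('rV[R]_d -> R) :=
  [set f : 'rV[R]_d -> R | [/\ measurable_fun [set: 'rV[R]_d] f,
               (\int[gibbs V]_x (f x ^+ 2)%:E < +oo)%E &
               (dirichlet_form alpha V f f < +oo)%E]].

Definition super_poincare alpha V (beta : R -> R) : Prop :=
  forall r f, 0 < r -> dirichlet_domain alpha V f ->
    (\int[gibbs V]_x (f x ^+ 2)%:E <=
     r%:E * dirichlet_form alpha V f f +
     (beta r)%:E * (\int[gibbs V]_x `|f x|%:E) ^+ 2)%E.

Definition h_low V r : R := inf [set expR (V x) | x in [set x | enorm x <= r]].

Definition H_up V r : R := sup [set expR (V x) | x in [set x | enorm x <= r]].

Definition W_integrand delta V x : R :=
  delta * enorm (grad V x) ^+ 2 - laplacian V x.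

Definition W_fun delta V r : \bar R :=
  ereal_inf [set (W_integrand delta V x)%:E | x in [set x | r <= enorm x]].

Definition W_inv delta V s : R :=
  inf [set r | 0 <= r /\ (s%:E <= W_fun delta V r)%E].

Definition cvg_pinfty_at_infinity f : Prop :=
  forall M : R, exists K : R, forall x, K < enorm x -> M < f x.

Definition rate alpha delta V (c1 c2 : R) r : R :=
  let rho := W_inv delta V (c2 * r `^ (- (2 / alpha))) in
  c1 * (1 + r `^ (- (d%:R / alpha)) * H_up V rho `^ (2 + d%:R / 2) *
            h_low V rho `^ (- (1 + d%:R / 2))).

End super_poincare.

(* Main.v *)
Require Import Defs.
From mathcomp Require Import all_boot all_order all_algebra.
From mathcomp Require Import all_classical all_reals all_analysis.
From mathcomp Require Import measurable_realfun.
From mathcomp Require Import ring lra.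
Import Order.TTheory GRing.Theory Num.Theory.
Import numFieldNormedType.Exports.

(** Write m for the density exp (- V), d for the dimension and E for the jump
    energy of f with weight m.  Everything follows from one estimate at a
    length scale t: if delta |grad V|^2 - Lap V is at least s outside the ball
    of radius rho, with s t^2 a large dimensional constant, then
      mu(f^2) <= C t^alpha E + C t^-d H(rho) mu(|f|)^2.                 (1)
    The mass of f^2 is split at radius rho + 2 sqrt d t.

    Far away, Lap m = (|grad V|^2 - Lap V) m >= s m.  Integrating this against
    a bump kernel k of width t and moving the two derivatives to k gives
    s int k m <= int m Lap k <= C t^-2 int_cube m ([kern_mean]): the average of
    m over a cube of size t beats its smoothing by the factor s t^2.  Replacing
    f(x)^2 by 2 f(y)^2 + 2 (f(x) - f(y))^2 and averaging in y against k thus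
    costs jumps of length at most C t, hence C t^alpha E, plus an arbitrarily
    small multiple of mu(f^2), which is absorbed ([far_estimate]).

    In the inner region every point x is at distance O(t) of a cube of size t
    that lies in the ball of radius rho, where 1 <= H(rho) m.  Averaging
    f(x)^2 <= (f(x) - f(y))^2 + 2 |f(x)| |f(y)| over y in that cube gives the
    right-hand side of (1) ([near_estimate]); since the cube is pulled inside,
    nothing is lost even if V explodes just outside radius rho.

    Solving C t^alpha = r makes s a multiple of r^(-2/alpha), so rho can be
    taken to be the inverse of W there.  The stated rate dominates t^-d H(rho)
    because H >= 1 and 1 <= h <= exp (V 0).  This works once t is small; for
    larger r the inequality follows from the one at a fixed small r, whose
    constant is put into c1 ([super_poincare_general]).

    For V = (1 + |x|^2)^eps an explicit computation gives
    delta |grad V|^2 - Lap V >= eps^2 (1 + |x|^2)^(2 eps - 1) for delta = 1/2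
    and |x| large ([W_power_ge]), so that rho^2 is at most of order
    s^(1/(2 eps - 1)) and log H(rho) of order s^(eps/(2 eps - 1)). *)

Set Implicit Arguments.
Unset Strict Implicit.
Unset Printing Implicit Defensive.

Local Open Scope classical_set_scope.
Local Open Scope ring_scope.

(** * Measurability and uniqueness of Lebesgue measure on row vectors *)

Section rV_measure.
Context {R : realType}.

Definition box n (A : 'I_n -> set R) : set 'rV[R]_n :=
  [set x | forall i, A i (x 0 i)].

Lemma measurable_box n (A : 'I_n -> set R) :
  (forall i, measurable (A i)) -> measurable (box A).
Proof.
move=> mA; rewrite [X in measurable X](_ : _ = \bigcap_(i in [set: 'I_n])
     ((fun x : 'rV[R]_n => x 0 i) @^-1` A i)); last first.
  by apply/seteqP; split => x /= h i; [move=> _|]; exact: h.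
apply: fin_bigcap_measurable => // i _.
by rewrite -[X in measurable X]setTI; exact: measurable_coord.
Qed.

Lemma lebesgue_rV_box n (A : 'I_n -> set R) :
  (forall i, measurable (A i)) ->
  lebesgue_rV (box A) = (\prod_(i < n) lebesgue_measure (A i))%E.
Proof. exact: lebesgue_rV_prod. Qed.

(** The sigma-algebra is generated by coordinates; an open set is the countable
    union of the boxes with rational centre and radius 1/k that it contains. *)
Lemma measurable_open_rV n (U : set 'rV[R]_n) : open U -> measurable U.
Proof.
move=> oU.
have invS k : 0 < k.+1%:R^-1 :> R by rewrite invr_gt0.
pose B (q : 'rV[rat]_n * nat) : set 'rV[R]_n :=
  box (fun i => `](ratr (q.1 0 i) - q.2.+1%:R^-1), (ratr (q.1 0 i) + q.2.+1%:R^-1)[%classic).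
rewrite (_ : U = \bigcup_q (if `[<B q `<=` U>] then B q else set0)).
  apply: countable_bigcupT_measurable => // q; case: ifP => // _.
  by apply: measurable_box => i; exact: measurable_itv.
apply/seteqP; split => [x Ux|x [q _]]; last first.
  by case: ifP => // /asboolP h; exact: h.
have /nbhs_ballP[e /= e0 eU] : nbhs x U by exact: open_nbhs_nbhs.
have [k _ /(_ _ (leqnn k)) ke] : \forall k \near \oo, k.+1%:R^-1 < e / 2 :> R.
  by apply: near_infty_natSinv_lt (PosNum _); rewrite divr_gt0.
have /choice[q qx] i : exists q : rat, ratr q \in `]x 0 i, (x 0 i + k.+1%:R^-1)[.
  by apply: rat_in_itvoo; rewrite ltrDl invr_gt0.
exists (\row_i q i, k) => //; rewrite /B/=.
move: (invS k) ke qx; move: (k.+1%:R^-1) => w w0 ke qx.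
case: ifPn => [_ i /=|/asboolP[]].
  have := qx i; rewrite !in_itv/= mxE => /andP[? ?]; apply/andP; split; lra.
move=> y /= By; apply: eU; split => // i j; rewrite (ord1 i) -ball_normE /ball_ /= ltr_norml.
have := By j; rewrite /= in_itv/= mxE => /andP[? ?].
have := qx j; rewrite in_itv/= => /andP[? ?].
apply/andP; split; lra.
Qed.

Lemma measurable_continuous_rV n (f : 'rV[R]_n -> R) :
  continuous f -> measurable_fun [set: 'rV[R]_n] f.
Proof.
move=> /continuousP cf.
apply: (measurability _ (@RGenOpens.measurableE R)) => _ [_ [a [b ->]] <-].
by rewrite setTI; apply: measurable_open_rV; apply: cf; exact: interval_open.
Qed.

Lemma coord_le_norm n (x : 'rV[R]_n) i : `|x 0 i| <= `|x|.
Proof. by rewrite [leRHS]mx_normrE; exact: (le_bigmax _ (fun ij : 'I_1 * 'I_n => `|x ij.1 ij.2|) (0, i)). Qed.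

(** Boxes form a pi-system that generates the sigma-algebra, and space is
    exhausted by the bounded ones. *)
Lemma lebesgue_rV_unique n (m : {measure set 'rV[R]_n -> \bar R}) :
  (forall A : 'I_n -> set R, (forall i, measurable (A i)) ->
     m (box A) = \prod_(i < n) lebesgue_measure (A i))%E ->
  forall A, measurable A -> m A = lebesgue_rV A.
Proof.
move=> mE.
pose G : set (set 'rV[R]_n) :=
  [set B | exists2 A : 'I_n -> set R, (forall i, measurable (A i)) & B = box A].
apply: (@measure_unique _ R _ G
  (fun k => box (fun=> `[- k%:R, k%:R]%classic))).
- apply/seteqP; split.
    apply: smallest_sub; first exact: smallest_sigma_algebra.
    move=> B; rewrite -bigcup_seq/= => -[i _ [A mA <-]].
    rewrite setTI; apply: sub_sigma_algebra.
    exists (fun j => if j == i then A else setT).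
      by move=> j; case: ifP.
    apply/seteqP; split => x /= h.
      by move=> j; case: eqP => // ->.
    by have := h i; rewrite eqxx.
  apply: smallest_sub; first exact: sigma_algebra_measurable.
  by move=> _ [A mA ->]; exact: measurable_box.
- move=> _ _ [A mA ->] [B mB ->]; exists (fun i => A i `&` B i).
    by move=> i; exact: measurableI.
  by apply/seteqP; split => x /=; [case=> hA hB i; split|move=> h; split=> i; have [] := h i].
- by move=> k; exists (fun=> `[- k%:R, k%:R]%classic).
- apply/seteqP; split => // x _.
  exists (Num.truncn `|x|).+1 => // i /=.
  rewrite in_itv/= -ler_norml (le_trans (coord_le_norm x i))//.
  exact/ltW/truncnS_gt.
- by move=> _ [A mA ->]; rewrite mE//; exact/esym/lebesgue_rV_box.
- move=> k; rewrite mE//.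
  have [c ->] : exists c, lebesgue_measure `[- k%:R, (k%:R : R)]%classic = c%:E.
    by rewrite lebesgue_measure_itv/=; case: ifP => _; eexists.
  by rewrite prodEFin ltry.
Qed.

Import HBNNSimple.

(** True for indicators by hypothesis, hence for simple functions, hence by
    monotone convergence. *)
Lemma ge0_integral_density d (T : measurableType d) (P mu : {measure set T -> \bar R})
  (g : T -> R) (f : T -> \bar R) :
  measurable_fun setT g -> (forall x, 0 <= g x) ->
  measurable_fun setT f -> (forall x, 0 <= f x)%E ->
  (forall A, measurable A -> P A = \int[mu]_(x in A) (g x)%:E)%E ->
  (\int[P]_x f x = \int[mu]_x (f x * (g x)%:E))%E.
Proof.
move=> mg g0 mf f0 PE.
pose f_ := nnsfun_approx measurableT mf.
transitivity (limn (fun n => \int[P]_x (f_ n x)%:E))%E.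
  rewrite -monotone_convergence//=.
  - by apply: eq_integral => x _; apply/esym/cvg_lim => //; exact: cvg_nnsfun_approx.
  - by move=> n; exact/measurable_EFinP/measurable_funP.
  - by move=> n y _; rewrite lee_fin.
  - by move=> y _ m n mn; rewrite lee_fin; exact/lefP/nd_nnsfun_approx.
have mgE : measurable_fun setT (EFin \o g) by exact/measurable_EFinP.
transitivity (limn (fun n => \int[mu]_x ((f_ n x)%:E * (g x)%:E)))%E; last first.
  rewrite -monotone_convergence//=.
  - apply: eq_integral => x _; apply/cvg_lim => //.
    by apply: cvgeZr => //; exact: cvg_nnsfun_approx.
  - move=> n; apply: emeasurable_funM => //.
    exact/measurable_EFinP/measurable_funP.
  - by move=> n y _; rewrite mule_ge0// lee_fin.
  - move=> y _ m n mn; rewrite lee_wpmul2r// ?lee_fin//.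
    exact/lefP/nd_nnsfun_approx.
congr (limn _); apply/funext => n.
move: (f_ n) => h.
under [LHS]eq_integral do rewrite fimfunE -fsumEFin//.
under [RHS]eq_integral => x _.
  rewrite fimfunE -fsumEFin// ge0_mule_fsuml; last first.
    by move=> r; rewrite EFinM nnfun_muleindic_ge0.
  over.
rewrite [LHS]ge0_integral_fsum; [|by []| | |exact: fimfunP]; last 2 first.
  - by move=> r; apply/measurable_EFinP; exact/measurableT_comp.
  - by move=> r x _; rewrite EFinM nnfun_muleindic_ge0.
rewrite [RHS]ge0_integral_fsum; [|by []| | |exact: fimfunP]; last 2 first.
  - move=> r; apply: emeasurable_funM => //.
    by apply/measurable_EFinP; exact/measurableT_comp.
  - by move=> r x _; rewrite mule_ge0 ?lee_fin// -lee_fin EFinM nnfun_muleindic_ge0.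
apply: eq_fsbigr => r _.
(* a negative value has an empty level set, which makes both sides vanish *)
have [r0|r0] := ltP r 0.
  by rewrite preimage_nnfun0 // !integral0_eq // => x _; rewrite indic0 mulr0 ?mul0e.
rewrite integralZl_indic_nnsfun//= integral_indic//= setIT PE//.
under [RHS]eq_integral do rewrite EFinM -muleA.
rewrite ge0_integralZl//=.
- rewrite integral_mkcond epatch_indic; congr (_ * _)%E.
  by apply: eq_integral => x _ /=; rewrite muleC.
- apply: emeasurable_funM => //; exact/measurable_EFinP.
- by move=> x _; rewrite mule_ge0// lee_fin.
Qed.

End rV_measure.

(** * Fubini along a coordinate and one-dimensional integration by parts *)

Section insertion.
Context {R : realType}.

Definition insert_coord n (i : 'I_n.+1) (p : R * 'rV[R]_n) : 'rV[R]_n.+1 :=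
  \row_j oapp (fun k => p.2 0 k) p.1 (unlift i j).

Lemma insert_coord_self n (i : 'I_n.+1) p : insert_coord i p 0 i = p.1.
Proof. by rewrite mxE unlift_none. Qed.

Lemma insert_coord_lift n (i : 'I_n.+1) p k : insert_coord i p 0 (lift i k) = p.2 0 k.
Proof. by rewrite mxE liftK. Qed.

Lemma insert_coord_line n (i : 'I_n.+1) a z :
  insert_coord i (a, z) = a *: delta_mx 0 i + insert_coord i (0, z).
Proof.
apply/rowP => j; rewrite !mxE eqxx/=; case: unliftP => [k|] ->/=.
  by rewrite eq_sym (negbTE (neq_lift _ _)) mulr0 add0r.
by rewrite eqxx mulr1 addr0.
Qed.

Lemma measurable_insert_coord n (i : 'I_n.+1) :
  measurable_fun [set: measurableTypeR R * 'rV[R]_n] (insert_coord i).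
Proof.
apply: measurable_fun_rV => j; under eq_fun do rewrite mxE.
case: unlift => [k|] /=; last exact: measurable_fst.
by apply: (measurableT_comp (@measurable_coord R n k)); exact: measurable_snd.
Qed.

(** Lebesgue measure is built by adding coordinates in front; this frees the
    choice of the coordinate, so that Fubini can single out any of them. *)
Lemma pushforward_insert_coord n (i : 'I_n.+1) A : measurable A ->
  pushforward (lebesgue_measure \x @lebesgue_rV R n)%E (insert_coord i) A = lebesgue_rV A.
Proof.
pose l : {sigma_finite_measure set (measurableTypeR R) -> \bar R} :=
  @lebesgue_measure R.
pose lm := (l \x @lebesgue_rV R n)%E.
pose m1 := measure_function_pushforward__canonical__measure_function_Measure lm (measurable_insert_coord i).
have m1E B : (forall j, measurable (B j)) -> m1 (box B) = (\prod_(j < n.+1) lebesgue_measure (B j))%E.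
  move=> mB.
  rewrite /m1/= /pushforward (_ : _ @^-1` _ = B i `*` box (fun k => B (lift i k))).
    rewrite /lm product_measure1E; [|exact: mB|exact: measurable_box].
    rewrite (bigD1_ord i)//= lebesgue_rV_box//.
  apply/seteqP; split => -[a z] /=.
    move=> h; split; first by have := h i; rewrite insert_coord_self.
    by move=> k /=; have := h (lift i k); rewrite insert_coord_lift.
  case=> Ba Bz j; case: (unliftP i j) => [k|] ->; rewrite ?insert_coord_self ?insert_coord_lift//.
exact: (@lebesgue_rV_unique _ _ m1).
Qed.

Lemma integral_rV_lines_eq0 n (i : 'I_n.+1) (F : 'rV[R]_n.+1 -> R) :
  (@lebesgue_rV R n.+1).-integrable setT (EFin \o F) ->
  (forall z, \int[lebesgue_measure]_a (F (insert_coord i (a, z)))%:E = 0)%E ->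
  (\int[@lebesgue_rV R n.+1]_x (F x)%:E = 0)%E.
Proof.
move=> iF F0.
pose l : {sigma_finite_measure set (measurableTypeR R) -> \bar R} :=
  @lebesgue_measure R.
pose lm := (l \x @lebesgue_rV R n)%E.
pose pm := measure_function_pushforward__canonical__measure_function_Measure
  lm (measurable_insert_coord i).
have mF : measurable_fun setT (EFin \o F) := measurable_int _ iF.
have ilm : lm.-integrable setT (EFin \o F \o insert_coord i).
  apply/integrableP; split; first exact: measurableT_comp (measurable_insert_coord i).
  move/integrableP : iF => [_]; apply: le_lt_trans.
  rewrite (eq_measure_integral pm); last first.
    by move=> A mA _; apply/esym; exact: (pushforward_insert_coord i mA).
  rewrite ge0_integral_pushforward//; [exact: measurable_insert_coord|].
  exact: measurableT_comp.
rewrite (eq_measure_integral pm); last first.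
  by move=> A mA _; apply/esym; exact: (pushforward_insert_coord i mA).
rewrite (integral_pushforward (measurable_insert_coord i))//.
rewrite preimage_setT -(integral21_prod_meas1 ilm).
by rewrite integral0_eq// => z _; exact: F0.
Qed.

(** [qbump] is only used on [-1, 1]: it vanishes with its first derivative at
    both ends, so that integrating by parts twice leaves no boundary term. *)
Definition qbump (u : R) : R := (1 - u ^+ 2) ^+ 2.
Definition ddqbump (u : R) : R := 12 * u ^+ 2 - 4.

Lemma is_derive_continuous (f f1 : R -> R) :
  (forall a : R, is_derive a (1 : R) f (f1 a)) -> continuous f.
Proof.
by move=> df a; apply: differentiable_continuous; apply/derivable1_diffP; exact: ex_derive.
Qed.

Lemma qbump_ibp (c t : R) (f f1 f2 : R -> R) : 0 < t ->
  (forall a : R, is_derive a (1 : R) f (f1 a)) ->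
  (forall a : R, is_derive a (1 : R) f1 (f2 a)) ->
  continuous f2 ->
  (\int[lebesgue_measure]_(a in `[(c - t)%R, (c + t)%R])
     (qbump ((a - c) / t) * f2 a - t ^- 2 * ddqbump ((a - c) / t) * f a)%:E = 0)%E.
Proof.
move=> t0 df df1 cf2.
have t_neq0 : t != 0 by rewrite gt_eqF.
pose b1 u : R := - 4 * u * (1 - u ^+ 2).
pose b3 u : R := 24 * u.
have db a : is_derive a (1 : R) (fun a => qbump ((a - c) / t)) (b1 ((a - c) / t) / t).
  rewrite /qbump /b1; apply: is_derive_eq.
  by rewrite /GRing.scale/=; field.
have db1 a : is_derive a (1 : R) (fun a => b1 ((a - c) / t)) (ddqbump ((a - c) / t) / t).
  rewrite /ddqbump /b1; apply: is_derive_eq.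
  by rewrite /GRing.scale/=; field.
have db2 a : is_derive a (1 : R) (fun a => ddqbump ((a - c) / t)) (b3 ((a - c) / t) / t).
  rewrite /ddqbump /b3; apply: is_derive_eq.
  by rewrite /GRing.scale/=; field.
(* the integrand is the derivative of k f' - k' f, which is 0 at both ends *)
pose G a := qbump ((a - c) / t) * f1 a - (t^-1 * b1 ((a - c) / t)) * f a.
have dG (a : R) : is_derive a (1 : R) G
    (qbump ((a - c) / t) * f2 a - t ^- 2 * ddqbump ((a - c) / t) * f a).
  have ? := df a; have ? := df1 a; have ? := db a; have ? := db1 a.
  rewrite /G; apply: is_derive_eq.
  by rewrite /GRing.scale/=; field.
have cG := is_derive_continuous dG.
rewrite (@continuous_FTC2 _ _ G).
- rewrite /G /qbump /b1.
  have -> : (c + t - c) / t = 1 by field.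
  have -> : (c - t - c) / t = -1 by field.
  by rewrite -EFinB; congr EFin; ring.
- lra.
- apply: continuous_subspaceT => a.
  apply: cvgB; apply: cvgM; [exact: is_derive_continuous db a|exact: cf2| |exact: is_derive_continuous df a].
  by apply: cvgM; [exact: cvg_cst|exact: is_derive_continuous db2 a].
- split.
  + by move=> a _; apply: ex_derive.
  + exact/cvg_at_right_filter/cG.
  + exact/cvg_at_left_filter/cG.
- by move=> a _; rewrite derive1E derive_val.
Qed.

End insertion.

(** * Subharmonicity tested against a bump kernel *)

Section kernel.
Context {R : realType}.

Definition cube n (y : 'rV[R]_n) (t : R) : set 'rV[R]_n :=
  box (fun i => `[y 0 i - t, y 0 i + t]%classic).

Lemma cubeE n (y x : 'rV[R]_n) t : cube y t x <-> forall i, `|x 0 i - y 0 i| <= t.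
Proof.
by split => h i; have := h i; rewrite /= in_itv/= ler_distlC ?ler_distl => /andP[? ?]; apply/andP; split; lra.
Qed.

Lemma cube_sym n (y x : 'rV[R]_n) t : cube y t x <-> cube x t y.
Proof. by rewrite !cubeE; split => h i; rewrite distrC. Qed.

Lemma measurable_cube n (y : 'rV[R]_n) t : measurable (cube y t).
Proof. by apply: measurable_box => i; exact: measurable_itv. Qed.

Lemma lebesgue_rV_cube n (y : 'rV[R]_n) t : 0 < t ->
  lebesgue_rV (cube y t) = ((2 * t) ^+ n)%:E.
Proof.
move=> t0; rewrite lebesgue_rV_box; last by move=> i; exact: measurable_itv.
rewrite (eq_bigr (fun=> (2 * t)%:E)) ?prodEFin ?prodr_const ?card_ord// => i _.
rewrite lebesgue_measure_itv/= lte_fin ifT; last lra.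
by rewrite -EFinB; congr EFin; ring.
Qed.

Lemma compact_cube n (y : 'rV[R]_n) t : compact (cube y t).
Proof. by apply: rV_compact => i; exact: segment_compact. Qed.

Lemma integrable_cube n (y : 'rV[R]_n) t (f : 'rV[R]_n -> R) : 0 < t ->
  continuous f -> (@lebesgue_rV R n).-integrable (cube y t) (EFin \o f).
Proof.
move=> t0 cf; apply: measurable_bounded_integrable.
- exact: measurable_cube.
- by rewrite (_ : _ (cube y t) = lebesgue_rV (cube y t))// lebesgue_rV_cube// ltry.
- by apply: measurable_funTS; exact: measurable_continuous_rV.
- have : compact (f @` cube y t).
    by apply: continuous_compact; [exact: continuous_subspaceT|exact: compact_cube].
  move/compact_bounded => [M [Mr h]]; exists M; split=> // z Mz x qx.
  by apply: h => //; exists x.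
Qed.

Lemma continuous_prod n (I : finType) (P : pred I) (F : I -> 'rV[R]_n -> R) :
  (forall i, continuous (F i)) -> continuous (fun x => \prod_(i | P i) F i x).
Proof.
by move=> cF; apply: continuous_big => //; exact: mul_continuous.
Qed.

Lemma continuous_scaled n (i : 'I_n) (y : 'rV[R]_n) t :
  continuous (fun x : 'rV[R]_n => (x 0 i - y 0 i) / t).
Proof.
move=> x; apply: (@cvgM _ _ (nbhs x) _ (fun x : 'rV[R]_n => x 0 i - y 0 i) (fun=> t^-1)); last exact: cvg_cst.
apply: (@cvgB _ _ _ (nbhs x) _ (fun x : 'rV[R]_n => x 0 i) (fun=> y 0 i)); last exact: cvg_cst.
exact: coord_continuous.
Qed.

Lemma continuous_qbump : continuous (@qbump R).
Proof.
apply: (@is_derive_continuous _ _ (fun u => - 4 * u * (1 - u ^+ 2))) => u.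
by rewrite /qbump; apply: is_derive_eq; rewrite /GRing.scale/=; ring.
Qed.

Lemma continuous_ddqbump : continuous (@ddqbump R).
Proof.
apply: (@is_derive_continuous _ _ (fun u => 24 * u)) => u.
by rewrite /ddqbump; apply: is_derive_eq; rewrite /GRing.scale/=; ring.
Qed.

Definition kern n (y : 'rV[R]_n) (t : R) (x : 'rV[R]_n) : R :=
  \prod_i qbump ((x 0 i - y 0 i) / t).

Definition ddkern n (i : 'I_n) (y : 'rV[R]_n) (t : R) (x : 'rV[R]_n) : R :=
  ddqbump ((x 0 i - y 0 i) / t) * \prod_(j | j != i) qbump ((x 0 j - y 0 j) / t).

Lemma continuous_qbump_scaled n (i : 'I_n) (y : 'rV[R]_n) t :
  continuous (fun x : 'rV[R]_n => qbump ((x 0 i - y 0 i) / t)).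
Proof.
move=> x.
apply: (@continuous_comp _ _ _ (fun x : 'rV[R]_n => (x 0 i - y 0 i) / t) (@qbump R)).
  exact: continuous_scaled.
exact: continuous_qbump.
Qed.

Lemma continuous_kern n (y : 'rV[R]_n) t : continuous (kern y t).
Proof. by apply: continuous_prod => i; exact: continuous_qbump_scaled. Qed.

Lemma continuous_ddkern n (i : 'I_n) (y : 'rV[R]_n) t : continuous (ddkern i y t).
Proof.
move=> x; apply: (@cvgM _ _ (nbhs x) _
  (fun x : 'rV[R]_n => ddqbump ((x 0 i - y 0 i) / t))
  (fun x => \prod_(j | j != i) qbump ((x 0 j - y 0 j) / t))).
  apply: (@continuous_comp _ _ _ (fun x : 'rV[R]_n => (x 0 i - y 0 i) / t) (@ddqbump R)).
    exact: continuous_scaled.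
  exact: continuous_ddqbump.
by apply: continuous_prod => j; exact: continuous_qbump_scaled.
Qed.

Lemma qbump_ge0 u : 0 <= qbump u :> R. Proof. exact: sqr_ge0. Qed.

Lemma qbump_le1 u : `|u| <= 1 -> qbump u <= 1 :> R.
Proof.
rewrite ler_norml /qbump => /andP[? ?].
rewrite expr_le1//; nra.
Qed.

Lemma kern_ge0 n (y x : 'rV[R]_n) t : 0 <= kern y t x.
Proof. by apply: prodr_ge0 => i _; exact: qbump_ge0. Qed.

Lemma cube_scaled n (y x : 'rV[R]_n) t i : 0 < t -> cube y t x ->
  `|(x 0 i - y 0 i) / t| <= 1.
Proof.
move=> t0 /cubeE/(_ i) h.
by rewrite normrM normfV (gtr0_norm t0) ler_pdivrMr// mul1r.
Qed.

Lemma kern_le1 n (y x : 'rV[R]_n) t : 0 < t -> cube y t x -> kern y t x <= 1.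
Proof.
move=> t0 qx; apply: prodr_ile1 => i _.
by rewrite qbump_ge0 qbump_le1// cube_scaled.
Qed.

Lemma ddkern_le n (i : 'I_n) (y x : 'rV[R]_n) t : 0 < t -> cube y t x ->
  ddkern i y t x <= 8.
Proof.
move=> t0 qx; rewrite /ddkern.
set p := \prod_(_ | _) _.
have p0 : 0 <= p by apply: prodr_ge0 => j _; exact: qbump_ge0.
have p1 : p <= 1.
  by apply: prodr_ile1 => j _; rewrite qbump_ge0 qbump_le1// cube_scaled.
have := cube_scaled i t0 qx; set u := _ / t; rewrite ler_norml => /andP[? ?].
have u2 : u ^+ 2 <= 1 by nra.
have := mulr_ge0 p0 (_ : 0 <= 1 - u ^+ 2); rewrite subr_ge0 => /(_ u2).
by rewrite /ddqbump; nra.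
Qed.

(** Differentiability in one direction, stated on lines so that the calculus
    of functions of one real variable applies. *)
Definition has_partial n (i : 'I_n) (f g : 'rV[R]_n -> R) :=
  forall w (a : R), is_derive a (1 : R) (fun b => f (b *: delta_mx 0 i + w))
                    (g (a *: delta_mx 0 i + w)).

Lemma continuous_line n (i : 'I_n) (f : 'rV[R]_n -> R) w :
  continuous f -> continuous (fun b : R => f (b *: delta_mx 0 i + w)).
Proof.
move=> cf b.
apply: (@continuous_comp _ _ _ (fun b : R => b *: delta_mx 0 i + w) f); last exact: cf.
apply: (@cvgD _ _ _ (nbhs b) _ (fun b : R => b *: delta_mx 0 i) (fun=> w)); last exact: cvg_cst.
by apply: (@cvgZr_tmp _ _ _ (nbhs b) _ id b (delta_mx 0 i)); exact: cvg_id.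
Qed.

(** On every line parallel to the i-th axis the kernel is a constant times a
    one-dimensional bump, and [qbump_ibp] applies. *)
Lemma kern_ibp n (i : 'I_n.+1) (m g h : 'rV[R]_n.+1 -> R) y t : 0 < t ->
  continuous m -> continuous h -> has_partial i m g -> has_partial i g h ->
  (\int[@lebesgue_rV R n.+1]_(x in cube y t)
    (kern y t x * h x - t ^- 2 * ddkern i y t x * m x)%:E = 0)%E.
Proof.
move=> t0 cm ch mg gh.
pose F x := kern y t x * h x - t ^- 2 * ddkern i y t x * m x.
have cF : continuous F.
  move=> x; apply: (@cvgB _ _ _ (nbhs x) _ (fun x => kern y t x * h x)
    (fun x => t ^- 2 * ddkern i y t x * m x)).
    apply: (@cvgM _ _ (nbhs x) _ (kern y t) h); [exact: continuous_kern|exact: ch].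
  apply: (@cvgM _ _ (nbhs x) _ (fun x => t ^- 2 * ddkern i y t x) m); last exact: cm.
  by apply: (@cvgM _ _ (nbhs x) _ (fun=> t ^- 2) (ddkern i y t)); [exact: cvg_cst|exact: continuous_ddkern].
rewrite integral_mkcond.
under eq_integral do rewrite restrict_EFin/=.
apply: (integral_rV_lines_eq0 (i := i)).
  rewrite -restrict_EFin -(integrable_mkcond _ (measurable_cube y t)).
  exact: integrable_cube.
move=> z.
have [zc|zc] := pselect (forall k, `|z 0 k - y 0 (lift i k)| <= t); last first.
  rewrite integral0_eq// => a _; rewrite patchE ifF//.
  apply/negP; rewrite inE => /cubeE hc; apply: zc => k.
  by have := hc (lift i k); rewrite insert_coord_lift.
pose P := \prod_(k < n) qbump ((z 0 k - y 0 (lift i k)) / t).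
have kE a : kern y t (insert_coord i (a, z)) = qbump ((a - y 0 i) / t) * P.
  rewrite /kern (bigD1_ord i)//= insert_coord_self; congr (_ * _).
  by apply: eq_bigr => k _; rewrite insert_coord_lift.
have ddkE a : ddkern i y t (insert_coord i (a, z)) = ddqbump ((a - y 0 i) / t) * P.
  rewrite /ddkern insert_coord_self; congr (_ * _).
  rewrite big_mkcond/= (bigD1_ord i)//= eqxx mul1r; apply: eq_bigr => k _.
  by rewrite eq_sym neq_lift insert_coord_lift.
pose w := insert_coord i (0, z).
pose I := `[y 0 i - t, y 0 i + t]%classic.
pose G a := qbump ((a - y 0 i) / t) * h (a *: delta_mx 0 i + w)
   - t ^- 2 * ddqbump ((a - y 0 i) / t) * m (a *: delta_mx 0 i + w).
have G0 : (\int[lebesgue_measure]_(a in I) (G a)%:E = 0)%E.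
  apply: (@qbump_ibp _ (y 0 i) t (fun a => m (a *: delta_mx 0 i + w))
    (fun a => g (a *: delta_mx 0 i + w)) (fun a => h (a *: delta_mx 0 i + w))) => //.
  exact: continuous_line.
have cG : continuous G.
  move=> a0.
  have cl (k : R) (q : R -> R) : continuous q -> {for a0, continuous (fun a : R => q ((a - k) / t))}.
    move=> cq; apply: (@continuous_comp _ _ _ (fun a : R => (a - k) / t) q); last exact: cq.
    apply: (@cvgM _ _ (nbhs a0) _ (fun a : R => a - k) (fun=> t^-1)); last exact: cvg_cst.
    by apply: (@cvgB _ _ _ (nbhs a0) _ id (fun=> k : R)); [exact: cvg_id|exact: cvg_cst].
  apply: (@cvgB _ _ _ (nbhs a0) _
     (fun a : R => qbump ((a - y 0 i) / t) * h (a *: delta_mx 0 i + w))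
     (fun a : R => t ^- 2 * ddqbump ((a - y 0 i) / t) * m (a *: delta_mx 0 i + w))).
    apply: (@cvgM _ _ (nbhs a0) _ (fun a : R => qbump ((a - y 0 i) / t))
       (fun a : R => h (a *: delta_mx 0 i + w))); last exact: continuous_line.
    exact/cl/continuous_qbump.
  apply: (@cvgM _ _ (nbhs a0) _ (fun a : R => t ^- 2 * ddqbump ((a - y 0 i) / t))
     (fun a : R => m (a *: delta_mx 0 i + w))); last exact: continuous_line.
  apply: (@cvgM _ _ (nbhs a0) _ (fun=> t ^- 2) (fun a : R => ddqbump ((a - y 0 i) / t))).
    exact: cvg_cst.
  exact/cl/continuous_ddqbump.
transitivity (\int[lebesgue_measure]_a ((fun a : R => (P * G a)%R%:E) \_ I) a)%E; last first.
  rewrite -integral_mkcond/=.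
  under eq_integral do rewrite EFinM.
  rewrite integralZl//; first by rewrite G0 mule0.
    exact: measurable_itv.
  apply: continuous_compact_integrable; first exact: segment_compact.
  exact: continuous_subspaceT.
apply: eq_integral => a _; rewrite restrict_EFin/= !patchE.
rewrite (_ : (insert_coord i (a, z) \in cube y t) = (a \in I)).
  case: ifP => // _; rewrite /F kE ddkE (insert_coord_line i a z) -/w /G; congr EFin; ring.
apply/idP/idP => /[!inE]; [move=> /cubeE/(_ i)|].
  by rewrite insert_coord_self/= ler_norml /I/= in_itv/= => /andP[? ?]; apply/andP; split; lra.
rewrite /I/= in_itv/= => /andP[? ?]; apply/cubeE => j.
case: (unliftP i j) => [k|] ->; first by rewrite insert_coord_lift.
by rewrite insert_coord_self/= ler_norml; apply/andP; split; lra.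
Qed.

(** If the sum of the second derivatives of m is at least s m, then
    s int k m <= int k Lap m = int m Lap k, and Lap k <= 8 d / t^2 on the cube
    because the second derivative of [qbump] is at most 8 there. *)
Lemma kern_mean n (m : 'rV[R]_n.+1 -> R) (g h : 'I_n.+1 -> 'rV[R]_n.+1 -> R) y t s :
  0 < t -> continuous m -> (forall i, continuous (h i)) ->
  (forall i, has_partial i m (g i)) -> (forall i, has_partial i (g i) (h i)) ->
  (forall x, 0 <= m x) ->
  (forall x, cube y t x -> s * m x <= \sum_i h i x) ->
  (s%:E * \int[@lebesgue_rV R n.+1]_(x in cube y t) (kern y t x * m x)%:E <=
  (8 * n.+1%:R / t ^+ 2)%:E * \int[@lebesgue_rV R n.+1]_(x in cube y t) (m x)%:E)%E.
Proof.
move=> t0 cm ch mg gh m0 sm.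
have mQ := measurable_cube y t.
pose F i x := kern y t x * h i x - t ^- 2 * ddkern i y t x * m x.
have ck : continuous (kern y t) by exact: continuous_kern.
have cM (f1 f2 : 'rV[R]_n.+1 -> R) : continuous f1 -> continuous f2 ->
    continuous (fun x => f1 x * f2 x).
  by move=> c1 c2 x; apply: (@cvgM _ _ (nbhs x) _ f1 f2); [exact: c1|exact: c2].
have cF i : continuous (F i).
  move=> x; apply: (@cvgB _ _ _ (nbhs x) _ (fun x => kern y t x * h i x)
    (fun x => t ^- 2 * ddkern i y t x * m x)); apply: (cM) => //.
  apply: (cM (fun=> t ^- 2) _); [exact: cst_continuous|exact: continuous_ddkern].
have ckm : continuous (fun x => kern y t x * m x) by exact: cM.
rewrite -integralZl//; last exact: (integrable_cube y t0 ckm).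
rewrite -integralZl//; last exact: (integrable_cube y t0 cm).
pose D := 8 * n.+1%:R / t ^+ 2.
apply: (@le_trans _ _ (\int[@lebesgue_rV R n.+1]_(x in cube y t)
   (\sum_i (F i x)%:E + (D * m x)%:E))%E).
  apply: le_integral => //.
  - exact: integrableZl (integrable_cube y t0 ckm).
  - apply: integrableD => //; last exact: integrableZl (integrable_cube y t0 cm).
    by apply: integrable_sum => // i _; exact: integrable_cube.
  move=> x /[!inE] qx; rewrite -EFinM sumEFin -EFinD lee_fin.
  have k0 := kern_ge0 y x t.
  apply: (@le_trans _ _ (\sum_i kern y t x * h i x)).
    by rewrite -mulr_sumr mulrCA ler_wpM2l// sm.
  rewrite -lerBlDl -sumrB.
  apply: (@le_trans _ _ (\sum_(i < n.+1) 8 / t ^+ 2 * m x)).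
    apply: ler_sum => i _; rewrite /F opprB addrCA subrr addr0.
    rewrite ler_wpM2r// mulrC ler_wpM2r ?invr_ge0 ?sqr_ge0//.
    exact: ddkern_le.
  by rewrite sumr_const card_ord -mulr_natl /D le_eqVlt; apply/orP; left; apply/eqP; ring.
rewrite integralD//; last 2 first.
- by apply: integrable_sum => // i _; exact: integrable_cube.
- exact: integrableZl (integrable_cube y t0 cm).
rewrite integral_sum//; last by move=> i; exact: integrable_cube.
rewrite big1 ?add0e//.
move=> i _; exact: (@kern_ibp _ i m (g i) (h i) y t t0 cm (ch i) (mg i) (gh i)).
Qed.

End kernel.

(** * The Euclidean norm *)

Section euclidean_norm.
Context {R : realType} {n : nat}.
Implicit Types x y : 'rV[R]_n.

Lemma enorm_sqr x : enorm x ^+ 2 = \sum_i x 0 i ^+ 2.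
Proof. by rewrite sqr_sqrtr// sumr_ge0// => i _; exact: sqr_ge0. Qed.

Lemma enorm_ge0 x : 0 <= enorm x.
Proof. exact: sqrtr_ge0. Qed.

Lemma coord_le_enorm x i : `|x 0 i| <= enorm x.
Proof.
rewrite -(@ler_pXn2r _ 2)// ?nnegrE ?enorm_ge0// enorm_sqr real_normK ?num_real//.
by rewrite (bigD1 i)//= lerDl sumr_ge0// => j _; exact: sqr_ge0.
Qed.

Lemma enorm_le_cube x c : 0 <= c -> (forall i, `|x 0 i| <= c) ->
  enorm x <= Num.sqrt n%:R * c.
Proof.
move=> c0 xc; rewrite -(@ler_pXn2r _ 2)// ?nnegrE ?enorm_ge0 ?mulr_ge0 ?sqrtr_ge0//.
rewrite enorm_sqr exprMn sqr_sqrtr// (le_trans (ler_sum _ (_ : forall i, true -> _ <= c ^+ 2)))//.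
  by move=> i _; rewrite -[x 0 i ^+ 2]real_normK ?num_real// lerXn2r ?nnegrE.
by rewrite sumr_const card_ord mulr_natl.
Qed.

Lemma enormZ (l : R) x : enorm (l *: x) = `|l| * enorm x.
Proof.
rewrite /enorm -sqrtr_sqr -sqrtrM ?sqr_ge0// mulr_sumr; congr Num.sqrt.
by apply: eq_bigr => i _; rewrite mxE exprMn.
Qed.

Lemma enormN x : enorm (- x) = enorm x.
Proof. by rewrite -scaleN1r enormZ normrN1 mul1r. Qed.

Lemma enorm_distC x y : enorm (x - y) = enorm (y - x).
Proof. by rewrite -enormN opprB. Qed.

Lemma enorm_eq0 x : enorm x = 0 -> x = 0.
Proof.
move=> x0; apply/rowP => i; rewrite mxE; apply/eqP; rewrite -normr_le0 -x0.
exact: coord_le_enorm.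
Qed.

Lemma enorm0 : enorm (0 : 'rV[R]_n) = 0.
Proof. by rewrite -(scale0r (0 : 'rV[R]_n)) enormZ normr0 mul0r. Qed.

(** 2 x_i y_i <= (q/p) x_i^2 + (p/q) y_i^2 with p, q the norms of x and y; the
    sum over i is Minkowski's inequality. *)
Lemma ler_enormD x y : enorm (x + y) <= enorm x + enorm y.
Proof.
have [x0|x0] := eqVneq (enorm x) 0.
  by rewrite (enorm_eq0 x0) add0r enorm0 add0r.
have [y0|y0] := eqVneq (enorm y) 0.
  by rewrite (enorm_eq0 y0) addr0 enorm0 addr0.
have xp : 0 < enorm x by rewrite lt_neqAle eq_sym x0 enorm_ge0.
have yp : 0 < enorm y by rewrite lt_neqAle eq_sym y0 enorm_ge0.
rewrite -(@ler_pXn2r _ 2)// ?nnegrE ?enorm_ge0 ?addr_ge0 ?enorm_ge0//.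
rewrite enorm_sqr.
apply: (@le_trans _ _ (\sum_i ((1 + enorm y / enorm x) * x 0 i ^+ 2 +
                               (1 + enorm x / enorm y) * y 0 i ^+ 2))).
  apply: ler_sum => i _; rewrite mxE -subr_ge0.
  set p := enorm x in xp x0 *; set q := enorm y in yp y0 *.
  have -> : (1 + q / p) * x 0 i ^+ 2 + (1 + p / q) * y 0 i ^+ 2 - (x 0 i + y 0 i) ^+ 2
     = (p * q) * (x 0 i / p - y 0 i / q) ^+ 2 by field; rewrite x0 y0.
  by rewrite mulr_ge0 ?sqr_ge0// mulr_ge0 ?ltW.
rewrite big_split/= -!mulr_sumr -!enorm_sqr le_eqVlt; apply/orP; left; apply/eqP.
by field; rewrite x0 y0.
Qed.

Lemma continuous_enorm : continuous (@enorm R n).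
Proof.
have cs : continuous (fun x : 'rV[R]_n => \sum_i x 0 i ^+ 2).
  apply: continuous_big => [|i _ x]; first exact: add_continuous.
  apply: (@continuous_comp _ _ _ (fun x : 'rV[R]_n => x 0 i) (fun u : R => u ^+ 2)).
    exact: coord_continuous.
  exact: exprn_continuous.
by move=> x; apply: continuous_comp; [exact: cs|exact: sqrt_continuous].
Qed.

Lemma measurable_enorm : measurable_fun [set: 'rV[R]_n] (@enorm R n).
Proof. by apply: measurable_continuous_rV; exact: continuous_enorm. Qed.

Lemma compact_enorm_ball (r : R) : compact [set x : 'rV[R]_n | enorm x <= r].
Proof.
apply: bounded_closed_compact.
  exists r; split; first exact: num_real.
  move=> M rM x /= xr; rewrite [leLHS]mx_normrE.
  apply/bigmax_leP; split; first by rewrite ltW// (le_lt_trans _ rM)// (le_trans (enorm_ge0 x)).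
  by move=> [i j] _ /=; rewrite (ord1 i) (le_trans (coord_le_enorm x j))// ltW// (le_lt_trans xr).
rewrite (_ : [set _ | _] = @enorm R n @^-1` [set u | u <= r])//.
by move/continuous_closedP : continuous_enorm; apply; exact: closed_le.
Qed.

End euclidean_norm.

(** * Weighted estimates for the jump energy *)

Section double_integral.
Context {R : realType} {n : nat}.
Local Notation T := 'rV[R]_n.
Local Notation L := (@lebesgue_rV R n).
Implicit Types g h : T * T -> R.

Definition iint g : \bar R := (\int[L \x L]_z (g z)%:E)%E.

Lemma le_iint g h : measurable_fun setT g -> measurable_fun setT h ->
  (forall z, 0 <= g z) -> (forall z, g z <= h z) -> (iint g <= iint h)%E.
Proof.
move=> mg mh g0 gh; apply: ge0_le_integral => //.
- by move=> z _; rewrite lee_fin.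
- exact/measurable_EFinP.
- exact/measurable_EFinP.
- by move=> z _; rewrite lee_fin.
Qed.

Lemma iintD g h : measurable_fun setT g -> measurable_fun setT h ->
  (forall z, 0 <= g z) -> (forall z, 0 <= h z) ->
  iint (fun z => g z + h z) = (iint g + iint h)%E.
Proof.
move=> mg mh g0 h0; rewrite /iint; under eq_integral do rewrite EFinD.
rewrite ge0_integralD//.
- by move=> z _; rewrite lee_fin.
- exact/measurable_EFinP.
- by move=> z _; rewrite lee_fin.
- exact/measurable_EFinP.
Qed.

Lemma iintZ (k : R) g : measurable_fun setT g -> (forall z, 0 <= g z) -> 0 <= k ->
  iint (fun z => k * g z) = (k%:E * iint g)%E.
Proof.
move=> mg g0 k0; rewrite /iint; under eq_integral do rewrite EFinM.
rewrite ge0_integralZl//.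
- exact/measurable_EFinP.
- by move=> z _; rewrite lee_fin.
Qed.

Lemma iint_ge0 g : (forall z, 0 <= g z) -> (0 <= iint g)%E.
Proof. by move=> g0; apply: integral_ge0 => z _; rewrite lee_fin. Qed.

Lemma iint_xy g : measurable_fun setT g -> (forall z, 0 <= g z) ->
  iint g = (\int[L]_x \int[L]_y (g (x, y))%:E)%E.
Proof.
move=> mg g0; rewrite /iint fubini_tonelli1//.
exact/measurable_EFinP.
Qed.

Lemma iint_yx g : measurable_fun setT g -> (forall z, 0 <= g z) ->
  iint g = (\int[L]_y \int[L]_x (g (x, y))%:E)%E.
Proof.
move=> mg g0; rewrite /iint fubini_tonelli2//.
exact/measurable_EFinP.
Qed.

Lemma measurable_affine_pair (a b : R) :
  measurable_fun setT (fun z : T * T => a *: z.1 + b *: z.2).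
Proof.
apply: measurable_fun_rV => i; under eq_fun do rewrite !mxE.
apply: measurable_funD; apply: measurable_funM => //.
  by apply: (measurableT_comp (@measurable_coord R n i)); exact: measurable_fst.
by apply: (measurableT_comp (@measurable_coord R n i)); exact: measurable_snd.
Qed.

Lemma measurable_subr_pair : measurable_fun setT (fun z : T * T => z.1 - z.2).
Proof.
rewrite (_ : (fun _ => _) = (fun z : T * T => 1 *: z.1 + (-1) *: z.2)).
  exact: measurable_affine_pair.
by apply/funext => z; rewrite scale1r scaleN1r.
Qed.

Lemma cube_sub (y x : T) t : cube y t x <-> cube 0 t (x - y).
Proof. by rewrite !cubeE; split => h i; have := h i; rewrite !mxE subr0. Qed.

Lemma kern_sub (y x : T) t : kern y t x = kern 0 t (x - y).
Proof. by apply: eq_bigr => i _; rewrite !mxE subr0. Qed.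

Lemma measurable_kern_pair t : measurable_fun setT (fun z : T * T => kern z.2 t z.1).
Proof.
under eq_fun do rewrite kern_sub.
apply: measurableT_comp measurable_subr_pair.
by apply: measurable_continuous_rV; exact: continuous_kern.
Qed.

Lemma measurable_cube_pair t : measurable [set z : T * T | cube z.2 t z.1].
Proof.
rewrite [X in measurable X](_ : _ = (fun z : T * T => z.1 - z.2) @^-1` cube 0 t).
  by rewrite -[X in measurable X]setTI; apply: measurable_subr_pair => //; exact: measurable_cube.
by apply/seteqP; split => z /= h; apply/cube_sub; move/cube_sub : h => //; rewrite subr0.
Qed.

Lemma measurable_shifted_cube_pair (l : R) t :
  measurable [set z : T * T | cube (l *: z.1) t z.2].
Proof.
rewrite [X in measurable X](_ : _ = (fun z : T * T => (- l) *: z.1 + 1 *: z.2) @^-1` cube 0 t).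
  by rewrite -[X in measurable X]setTI; apply: measurable_affine_pair => //; exact: measurable_cube.
have E (z : T * T) : (- l) *: z.1 + 1 *: z.2 = z.2 - l *: z.1.
  by rewrite scaleNr scale1r addrC.
by apply/seteqP; split => z /=; rewrite E; [exact: iffLR (cube_sub _ _ _)|exact: iffRL (cube_sub _ _ _)].
Qed.

Lemma measurable_enorm_pair : measurable_fun setT (fun z : T * T => enorm (z.1 - z.2)).
Proof. by apply: measurableT_comp measurable_subr_pair; exact: measurable_enorm. Qed.

Lemma measurable_slice g : measurable_fun setT g -> (forall z, 0 <= g z) ->
  measurable_fun setT (fun x => \int[L]_y (g (x, y))%:E)%E.
Proof.
move=> mg g0; apply: (measurable_fun_fubini_tonelli_F (EFin \o g)) => //.
exact/measurable_EFinP.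
Qed.

Lemma iint_slice (q : T -> R) g : measurable_fun setT q -> (forall x, 0 <= q x) ->
  measurable_fun setT g -> (forall z, 0 <= g z) ->
  iint (fun z => q z.1 * g z) = (\int[L]_x ((q x)%:E * \int[L]_y (g (x, y))%:E))%E.
Proof.
move=> mq q0 mg g0; rewrite iint_xy.
- apply: eq_integral => x _ /=; under eq_integral do rewrite EFinM.
  rewrite ge0_integralZl//.
  + by apply/measurable_EFinP; apply: measurableT_comp mg _; exact: pair1_measurable.
  + by move=> y _; rewrite lee_fin.
  + by rewrite lee_fin.
- apply: measurable_funM => //.
  by apply: measurableT_comp mq _; exact: measurable_fst.
- by move=> z; exact: mulr_ge0.
Qed.

Lemma iint_slice_ge (c : R) (q : T -> R) g : 0 <= c ->
  measurable_fun setT q -> (forall x, 0 <= q x) ->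
  measurable_fun setT g -> (forall z, 0 <= g z) ->
  (forall x, c%:E <= \int[L]_y (g (x, y))%:E)%E ->
  (c%:E * \int[L]_x (q x)%:E <= iint (fun z => q z.1 * g z)%R)%E.
Proof.
move=> c0 mq q0 mg g0 cg; rewrite iint_slice// -ge0_integralZl//; last 2 first.
- exact/measurable_EFinP.
- by move=> x _; rewrite lee_fin.
apply: ge0_le_integral => //.
- by move=> x _; rewrite mule_ge0 ?lee_fin.
- by apply: measurable_funeM; exact/measurable_EFinP.
- by apply: emeasurable_funM; [exact/measurable_EFinP|exact: measurable_slice].
- by move=> x _; rewrite muleC lee_wpmul2l ?lee_fin.
Qed.

Lemma iint_slice_le (c : R) (q : T -> R) g : 0 <= c ->
  measurable_fun setT q -> (forall x, 0 <= q x) ->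
  measurable_fun setT g -> (forall z, 0 <= g z) ->
  (forall x, \int[L]_y (g (x, y))%:E <= c%:E)%E ->
  (iint (fun z => q z.1 * g z)%R <= c%:E * \int[L]_x (q x)%:E)%E.
Proof.
move=> c0 mq q0 mg g0 cg; rewrite iint_slice// -ge0_integralZl//; last 2 first.
- exact/measurable_EFinP.
- by move=> x _; rewrite lee_fin.
apply: ge0_le_integral => //.
- by move=> x _; rewrite mule_ge0 ?lee_fin// integral_ge0// => y _; rewrite lee_fin.
- by apply: emeasurable_funM; [exact/measurable_EFinP|exact: measurable_slice].
- by apply: measurable_funeM; exact/measurable_EFinP.
- by move=> x _; rewrite [leRHS]muleC lee_wpmul2l ?lee_fin.
Qed.

End double_integral.

(** Nonnegativity of products.  Squares come before products because a square
    unifies with a product. *)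
Ltac nng := repeat first [done | exact: sqr_ge0 | apply: mulr_ge0].

Section estimates.
Context {R : realType} {n : nat}.
Local Notation T := 'rV[R]_n.
Local Notation L := (@lebesgue_rV R n).
Variables (alpha : R) (f m : T -> R).
Hypothesis alpha0 : 0 < alpha.
Hypothesis mf : measurable_fun setT f.
Hypothesis mm : measurable_fun setT m.
Hypothesis m0 : forall x, 0 <= m x.

Let p : R := n%:R + alpha.

Definition jump_density (z : T * T) : R :=
  (f z.1 - f z.2) * (f z.1 - f z.2) / enorm (z.1 - z.2) `^ p * m z.1.

Definition jump_energy := iint jump_density.
Definition mass2 := (\int[L]_x (f x ^+ 2 * m x)%:E)%E.
Definition mass1 := (\int[L]_x (`|f x| * m x)%:E)%E.

Let sqgap (z : T * T) : R := (f z.1 - f z.2) ^+ 2.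

Lemma measurable_f1 : measurable_fun setT (fun z : T * T => f z.1).
Proof. by apply: measurableT_comp mf _; exact: measurable_fst. Qed.
Lemma measurable_f2 : measurable_fun setT (fun z : T * T => f z.2).
Proof. by apply: measurableT_comp mf _; exact: measurable_snd. Qed.
Lemma measurable_m1 : measurable_fun setT (fun z : T * T => m z.1).
Proof. by apply: measurableT_comp mm _; exact: measurable_fst. Qed.
Lemma measurable_sqgap : measurable_fun setT sqgap.
Proof. by apply: measurable_funX; apply: measurable_funB; [exact: measurable_f1|exact: measurable_f2]. Qed.

Lemma jump_density_ge0 z : 0 <= jump_density z.
Proof.
by rewrite /jump_density mulr_ge0// divr_ge0 ?powR_ge0// -expr2 sqr_ge0.
Qed.

Lemma measurable_jump_density : measurable_fun setT jump_density.
Proof.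
apply: measurable_funM measurable_m1.
apply: measurable_funM.
  by apply: measurable_funM; apply: measurable_funB; exact: measurable_f1 || exact: measurable_f2.
under eq_fun do rewrite -powRN.
exact: (measurableT_comp (measurable_powR (- p)) measurable_enorm_pair).
Qed.

(** Jumps of length at most r are seen by the energy with intensity at least
    r^-(d + alpha). *)
Lemma short_jumps (r : R) (w : T * T -> R) : 0 <= r -> measurable_fun setT w ->
  (forall z, 0 <= w z <= 1) ->
  (forall z, r < enorm (z.1 - z.2) -> w z = 0) ->
  (iint (fun z => (w z * sqgap z * m z.1)%R) <= (r `^ p)%:E * jump_energy)%E.
Proof.
move=> r0 mw w01 wr; rewrite -iintZ ?powR_ge0//; [|exact: measurable_jump_density|exact: jump_density_ge0].
have w0 z : 0 <= w z by case/andP: (w01 z).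
have w1 z : w z <= 1 by case/andP: (w01 z).
have D0 z : 0 <= sqgap z by exact: sqr_ge0.
apply: le_iint.
- by apply: measurable_funM measurable_m1; apply: measurable_funM measurable_sqgap.
- by apply: measurable_funM => //; exact: measurable_jump_density.
- by move=> z; do !apply: mulr_ge0 => //; exact: jump_density_ge0.
move=> z.
have [rz|zr] := ltP r (enorm (z.1 - z.2)).
  by rewrite wr// !mul0r mulr_ge0 ?powR_ge0// jump_density_ge0.
rewrite /jump_density mulrA ler_wpM2r//.
apply: (@le_trans _ _ (sqgap z)); first by rewrite ler_piMl.
rewrite -expr2 -/(sqgap z).
have [z0|z0] := eqVneq (enorm (z.1 - z.2)) 0.
  suff -> : sqgap z = 0 by rewrite !(mul0r, mulr0).
  by move/enorm_eq0 : z0 => /eqP; rewrite subr_eq0 /sqgap => /eqP ->; rewrite subrr expr0n.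
have zp : 0 < enorm (z.1 - z.2) by rewrite lt_neqAle eq_sym z0 enorm_ge0.
rewrite mulrCA ler_peMr// ler_pdivlMr ?powR_gt0// mul1r.
by rewrite ge0_ler_powR ?nnegrE// ?enorm_ge0// /p addr_ge0// ltW.
Qed.

Let cubes t : set (T * T) := [set z | cube z.2 t z.1].
Let kernw t (z : T * T) : R := \1_(cubes t) z * kern z.2 t z.1.

Lemma kernw_ge0 t z : 0 <= kernw t z.
Proof. by rewrite /kernw mulr_ge0// ?kern_ge0. Qed.

Lemma kernw_le1 t z : 0 < t -> kernw t z <= 1.
Proof.
move=> t0; rewrite /kernw indicE; case: (boolP (_ \in _)) => [|_]; last by rewrite mul0r.
by rewrite inE /cubes/= mul1r => h; exact: kern_le1.
Qed.

Lemma measurable_kernw t : measurable_fun setT (kernw t).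
Proof.
apply: measurable_funM; last exact: measurable_kern_pair.
by apply: measurable_indic; exact: measurable_cube_pair.
Qed.

Lemma measurable_cubes t : measurable_fun setT (\1_(cubes t) : T * T -> R).
Proof. by apply: measurable_indic; exact: measurable_cube_pair. Qed.

Lemma cube_enorm t (x y : T) : 0 < t -> cube y t x -> enorm (x - y) <= Num.sqrt n%:R * t.
Proof.
move=> t0 /cubeE h; apply: enorm_le_cube; first exact: ltW.
by move=> i; rewrite !mxE.
Qed.

(** On the half-size cube every factor of the kernel is at least
    (1 - 1/4)^2 = 9/16. *)
Lemma kern_integral_ge t x : 0 < t ->
  (((9 / 16) ^+ n * t ^+ n)%:E <= \int[L]_y (kernw t (x, y))%:E)%E.
Proof.
move=> t0.
have t20 : 0 < t / 2 by rewrite divr_gt0.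
have -> : (((9 / 16) ^+ n * t ^+ n)%:E = \int[L]_y ((9 / 16) ^+ n * \1_(cube x (t / 2)) y)%:E)%E.
  under eq_integral do rewrite EFinM.
  rewrite ge0_integralZl//; last first.
    by apply/measurable_EFinP; apply: measurable_indic; exact: measurable_cube.
  rewrite integral_indic//; last exact: measurable_cube.
  rewrite setIT [X in (_ * X)%E](lebesgue_rV_cube x t20) -EFinM.
  by congr (_ * _ ^+ _)%:E; field.
apply: ge0_le_integral => //.
- apply/measurable_EFinP; apply: measurable_funM => //.
  by apply: measurable_indic; exact: measurable_cube.
- apply/measurable_EFinP; apply: measurableT_comp (measurable_kernw t) _; exact: pair1_measurable.
move=> y _; rewrite lee_fin indicE; case: (boolP (_ \in _)) => [|_]; last by rewrite mulr0 kernw_ge0.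
rewrite inE mulr1 => /cubeE yx.
have xy : cubes t (x, y).
  by apply/cubeE => i /=; rewrite distrC (le_trans (yx i))// ler_pdivrMr//; lra.
rewrite /kernw indicE mem_set// mul1r/=.
rewrite -[leLHS]mulr1 -[n in _ ^+ n]card_ord -prodr_const mulr1.
apply: ler_prod => i _; rewrite divr_ge0//=.
have : `|(x 0 i - y 0 i) / t| <= 1 / 2.
  rewrite normrM normfV (gtr0_norm t0) ler_pdivrMr// distrC (le_trans (yx i))//.
  by lra.
set u := _ / t; rewrite ler_norml => /andP[? ?].
have u2 : u ^+ 2 <= 1 / 4 by nra.
rewrite /qbump; nra.
Qed.

Lemma measurable_enorm_gt (r : R) : measurable [set x : T | r < enorm x].
Proof.
rewrite [X in measurable X](_ : _ = @enorm R n @^-1` `]r, +oo[%classic).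
  by rewrite -[X in measurable X]setTI; apply: measurable_enorm.
by apply/seteqP; split => x /=; rewrite in_itv/= andbT.
Qed.

Lemma integral_indicr (X : set T) (q : T -> R) :
  (\int[L]_(x in X) (q x)%:E = \int[L]_x (q x * \1_X x)%:E)%E.
Proof.
by rewrite integral_mkcond epatch_indic; apply: eq_integral => x _ /=; rewrite EFinM.
Qed.

Lemma measurable_sqr_density : measurable_fun setT (fun x => f x ^+ 2 * m x).
Proof. by apply: measurable_funM mm; exact: measurable_funX. Qed.

Lemma sqr_le2D (u v : R) : u ^+ 2 <= 2 * v ^+ 2 + 2 * (u - v) ^+ 2.
Proof. have := sqr_ge0 (u - 2 * v); nra. Qed.

Variables A E : R.
Hypothesis AE : mass2 = A%:E.
Hypothesis EE : jump_energy = E%:E.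

Lemma short_jumps_fin (r : R) (v : T * T -> R) : 0 <= r -> measurable_fun setT v ->
  (forall z, 0 <= v z <= 1) ->
  (forall z, r < enorm (z.1 - z.2) -> v z = 0) ->
  (iint (fun z => (v z * sqgap z * m z.1)%R) <= (r `^ p * E)%:E)%E.
Proof. by move=> *; rewrite EFinM -EE; exact: short_jumps. Qed.

(** Exchanges f(y)^2 for f(x)^2 at the price of short jumps; the weight stays at
    x, and the y-integral is then the volume of a cube. *)
Lemma cube_mass (t : R) : 0 < t ->
  (iint (fun z => (\1_(cubes t) z * f z.2 ^+ 2 * m z.1)%R) <=
   (2 * ((2 * t) ^+ n * A) + 2 * ((Num.sqrt n%:R * t) `^ p * E))%:E)%E.
Proof.
move=> t0; set a := Num.sqrt n%:R * t.
have a0 : 0 <= a by rewrite mulr_ge0// ?sqrtr_ge0 ?ltW.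
have S01 z : 0 <= (\1_(cubes t) z : R) <= 1 by rewrite indicE; case: (_ \in _); rewrite /= lexx ler01.
have S0 z : 0 <= (\1_(cubes t) z : R) by case/andP: (S01 z).
have q0 x : 0 <= f x ^+ 2 * m x by rewrite mulr_ge0 ?sqr_ge0.
have mfm1 : measurable_fun setT (fun z : T * T => f z.1 ^+ 2 * m z.1).
  by apply: measurable_funM measurable_m1; apply: measurable_funX; exact: measurable_f1.
have mSD : measurable_fun setT (fun z => \1_(cubes t) z * sqgap z * m z.1).
  by apply: measurable_funM measurable_m1; apply: measurable_funM measurable_sqgap; exact: measurable_cubes.
have mSq : measurable_fun setT (fun z => f z.1 ^+ 2 * m z.1 * \1_(cubes t) z).
  by apply: measurable_funM => //; exact: measurable_cubes.
have D0 z : 0 <= sqgap z by exact: sqr_ge0.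
have SD0 z : 0 <= \1_(cubes t) z * sqgap z * m z.1 by nng.
have Sq0 z : 0 <= f z.1 ^+ 2 * m z.1 * \1_(cubes t) z by nng.
apply: (@le_trans _ _ (iint (fun z => 2 * (f z.1 ^+ 2 * m z.1 * \1_(cubes t) z) +
                                     2 * (\1_(cubes t) z * sqgap z * m z.1)))).
  apply: le_iint.
  - apply: measurable_funM measurable_m1; apply: measurable_funM; first exact: measurable_cubes.
    by apply: measurable_funX; exact: measurable_f2.
  - by apply: measurable_funD; apply: measurable_funM.
  - by move=> z; nng.
  move=> z.
  rewrite (_ : 2 * _ + 2 * _ = \1_(cubes t) z * (2 * f z.1 ^+ 2 + 2 * sqgap z) * m z.1); last by ring.
  rewrite ler_wpM2r// ler_wpM2l//.
  by have := sqr_le2D (f z.2) (f z.1); rewrite /sqgap -(opprB (f z.1)) sqrrN.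
rewrite iintD//; last 4 first.
- exact: measurable_funM.
- exact: measurable_funM.
- by move=> z; rewrite mulr_ge0.
- by move=> z; rewrite mulr_ge0.
rewrite !iintZ// [leRHS]EFinD; apply: leeD; rewrite [leRHS]EFinM lee_wpmul2l//.
  rewrite EFinM -AE; apply: iint_slice_le => //.
  - by rewrite exprn_ge0// mulr_ge0// ltW.
  - exact: measurable_sqr_density.
  - exact: measurable_cubes.
  - move=> x; rewrite le_eqVlt; apply/orP; left; apply/eqP.
    rewrite (eq_integral (fun y => (\1_(cube x t) y)%:E)).
      by rewrite integral_indic ?setIT; [exact: lebesgue_rV_cube| |exact: measurable_cube].
    move=> y _; rewrite !indicE; congr (_%:R%:E); congr nat_of_bool.
    by apply/idP/idP; rewrite !inE => /cube_sym.
apply: short_jumps_fin => //; first exact: measurable_cubes.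
move=> z az; rewrite indicE memNset// => /(cube_enorm t0); apply/negP.
by rewrite -ltNge.
Qed.

(** The mass f(x)^2 m(x) is moved from x to y at the price of short jumps.  With
    f^2 now frozen at y, the x-integral is that of k m over the cube around y,
    where [hmean] gains the factor [kappa]; [cube_mass] moves the mass back. *)
Lemma far_estimate (t rho kappa : R) (a := Num.sqrt n%:R * t) : 0 < t -> 0 <= kappa ->
  (forall y, rho + a < enorm y ->
    (\int[L]_(x in cube y t) (kern y t x * m x)%:E <=
    kappa%:E * \int[L]_(x in cube y t) (m x)%:E)%E) ->
  (((9 / 16) ^+ n * t ^+ n)%:E *
     \int[L]_(x in [set x | (rho + 2 * a < enorm x)%R]) (f x ^+ 2 * m x)%:E <=
   (4 * kappa * (2 * t) ^+ n * A + (4 * kappa + 2) * a `^ p * E)%:E)%E.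
Proof.
move=> t0 k0 hmean.
set far := [set x | _].
have mfar : measurable far by exact: measurable_enorm_gt.
have a0 : 0 <= a by rewrite mulr_ge0// ?sqrtr_ge0 ?ltW.
pose q x := f x ^+ 2 * m x * \1_far x.
have q0 x : 0 <= q x by nng.
have mq : measurable_fun setT q.
  by apply: measurable_funM; [exact: measurable_sqr_density|exact: measurable_indic].
have w01 z : 0 <= kernw t z <= 1 by rewrite kernw_ge0 kernw_le1.
have w0 z := kernw_ge0 t z.
have D0 z : 0 <= sqgap z by exact: sqr_ge0.
pose G z := \1_far z.1 * kernw t z * f z.2 ^+ 2 * m z.1.
have G0 z : 0 <= G z by nng.
have mfar1 : measurable_fun setT (fun z : T * T => \1_far z.1 : R).
  by apply: (measurableT_comp (measurable_indic mfar)); exact: measurable_fst.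
have mG : measurable_fun setT G.
  apply: measurable_funM measurable_m1; apply: measurable_funM.
    by apply: measurable_funM => //; exact: measurable_kernw.
  by apply: measurable_funX; exact: measurable_f2.
have mwD : measurable_fun setT (fun z => kernw t z * sqgap z * m z.1).
  by apply: measurable_funM measurable_m1; apply: measurable_funM measurable_sqgap; exact: measurable_kernw.
have wD0 z : 0 <= kernw t z * sqgap z * m z.1 by nng.
rewrite integral_indicr.
apply: le_trans (iint_slice_ge (q := q) (g := kernw t) _ mq q0 (measurable_kernw t) w0 _) _.
- by rewrite mulr_ge0// exprn_ge0// ltW.
- by move=> x; exact: kern_integral_ge.
apply: (@le_trans _ _ (iint (fun z => 2 * G z + 2 * (kernw t z * sqgap z * m z.1)))).
  apply: le_iint.
  - apply: measurable_funM; last exact: measurable_kernw.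
    by apply: measurableT_comp mq _; exact: measurable_fst.
  - by apply: measurable_funD; apply: measurable_funM.
  - by move=> z; rewrite mulr_ge0.
  move=> z; rewrite /q /G indicE; case: (_ \in _); rewrite !(mulr1, mul1r, mulr0, mul0r); last first.
    by rewrite add0r mulr_ge0.
  rewrite (_ : 2 * _ + 2 * _ = (2 * f z.2 ^+ 2 + 2 * sqgap z) * m z.1 * kernw t z); last by ring.
  by rewrite ler_wpM2r// ler_wpM2r// sqr_le2D.
rewrite iintD//; last 4 first.
- exact: measurable_funM.
- exact: measurable_funM.
- by move=> z; rewrite mulr_ge0.
- by move=> z; rewrite mulr_ge0.
rewrite !iintZ//.
pose B := 2 * ((2 * t) ^+ n * A) + 2 * (a `^ p * E).
rewrite (_ : 4 * _ * _ * _ + _ = 2 * (kappa * B) + 2 * (a `^ p * E)); last by rewrite /B; ring.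
rewrite [leRHS]EFinD; apply: leeD; rewrite [leRHS]EFinM lee_wpmul2l//; last first.
  apply: short_jumps_fin => //; first exact: measurable_kernw.
  move=> z az; rewrite /kernw indicE memNset ?mul0r// => /(cube_enorm t0); apply/negP.
  by rewrite -ltNge.
have mSf : measurable_fun setT (fun z => \1_(cubes t) z * f z.2 ^+ 2 * m z.1).
  apply: measurable_funM measurable_m1; apply: measurable_funM; first exact: measurable_cubes.
  by apply: measurable_funX; exact: measurable_f2.
have S0 z : 0 <= (\1_(cubes t) z : R) by rewrite indicE.
have Sf0 z : 0 <= \1_(cubes t) z * f z.2 ^+ 2 * m z.1 by nng.
apply: (@le_trans _ _ (kappa%:E * iint (fun z => (\1_(cubes t) z * f z.2 ^+ 2 * m z.1)%R))%E); last first.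
  by rewrite EFinM lee_wpmul2l//; exact: cube_mass.
rewrite -iintZ// !iint_yx//; last 2 first.
- exact: measurable_funM.
- by move=> z; rewrite mulr_ge0.
apply: ge0_le_integral => //.
- by move=> y _; apply: integral_ge0 => x _; rewrite lee_fin.
- apply: (measurable_fun_fubini_tonelli_G (EFin \o G)) => //.
  exact/measurable_EFinP.
- apply: (measurable_fun_fubini_tonelli_G (EFin \o (fun z => kappa * (\1_(cubes t) z * f z.2 ^+ 2 * m z.1)))) => //.
    by apply/measurable_EFinP; exact: measurable_funM.
  by move=> z /=; rewrite lee_fin mulr_ge0.
move=> y _.
have [yr|yr] := ltP (rho + a) (enorm y); last first.
  rewrite [leLHS]integral0_eq.
    by apply: integral_ge0 => x _; rewrite lee_fin mulr_ge0.
  move=> x _; rewrite /G /kernw !indicE; case: (boolP (_ \in _)) => [|_]; last by rewrite !mul0r.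
  rewrite inE /far/= => xr; rewrite memNset ?(mul0r, mulr0)//= => /(cube_enorm t0).
  rewrite -/a => h2; have h1 := ler_enormD (x - y) y; rewrite subrK in h1.
  lra.
have c0 := sqr_ge0 (f y).
have SE x : \1_(cubes t) (x, y) = \1_(cube y t) x :> R.
  by rewrite !indicE; congr (_%:R); congr nat_of_bool; apply/idP/idP; rewrite !inE.
have mcube : measurable_fun setT (\1_(cube y t) : T -> R).
  by apply: measurable_indic; exact: measurable_cube.
have mkm : measurable_fun setT (fun x => kern y t x * m x * \1_(cube y t) x).
  apply: measurable_funM => //; apply: measurable_funM => //.
  by apply: measurable_continuous_rV; exact: continuous_kern.
have kern0 x := kern_ge0 y x t.
have i0 x : 0 <= (\1_(cube y t) x : R) by rewrite indicE.
apply: (@le_trans _ _ (\int[L]_x ((f y ^+ 2)%:E * (kern y t x * m x * \1_(cube y t) x)%:E))%E).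
  apply: ge0_le_integral => //.
  - by move=> x _; rewrite lee_fin.
  - by apply/measurable_EFinP; apply: measurableT_comp mG _; exact: pair2_measurable.
  - by apply: measurable_funeM; exact/measurable_EFinP.
  move=> x _; rewrite -EFinM lee_fin /G /kernw SE/=.
  have l1 : (\1_far x : R) <= 1 by rewrite indicE; case: (_ \in _).
  have := i0 x; have := kern0 x; move: l1; move: (\1_far x : R) (\1_(cube y t) x : R) => u v u1 k1 v1.
  rewrite (_ : u * _ * _ * _ = u * (f y ^+ 2 * (kern y t x * m x * v))); last by ring.
  by rewrite ler_piMl//; nng.
rewrite ge0_integralZl; [|by []|exact/measurable_EFinP|by move=> x _; rewrite lee_fin; nng|by []].
rewrite -integral_indicr.
apply: (@le_trans _ _ ((f y ^+ 2)%:E * (kappa%:E * \int[L]_(x in cube y t) (m x)%:E))%E).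
  by apply: lee_wpmul2l; [rewrite lee_fin|exact: hmean].
rewrite integral_indicr muleA -EFinM -ge0_integralZl; last 4 first.
- by [].
- by apply/measurable_EFinP; exact: measurable_funM.
- by move=> x _; rewrite lee_fin; nng.
- by rewrite lee_fin; nng.
rewrite le_eqVlt; apply/orP; left; apply/eqP; apply: eq_integral => x _.
by rewrite -EFinM SE/=; congr EFin; ring.
Qed.

(** The partner y of x ranges over the cube around l x, where l <= 1 is such that
    this cube lies in the ball of radius rho.  The cross term
    |f(x)| |f(y)| m(x) is bounded through 1 <= H m(y) by the product of two
    copies of int |f| m. *)
Lemma near_estimate (t rho H N : R) (a := Num.sqrt n%:R * t) :
  0 < t -> 0 < rho -> a <= rho -> 0 <= H -> 0 <= N ->
  (forall x, enorm x <= rho -> 1 <= H * m x) -> mass1 = N%:E ->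
  (((2 * t) ^+ n)%:E *
     \int[L]_(x in [set x | (enorm x <= rho + 2 * a)%R]) (f x ^+ 2 * m x)%:E <=
   ((4 * a) `^ p * E + 2 * (H * (N * N)))%:E)%E.
Proof.
move=> t0 rho0 arho H0 N0 Hm NE.
set near := [set x | _].
have a0 : 0 <= a by rewrite mulr_ge0// ?sqrtr_ge0 ?ltW.
have mnear : measurable near.
  rewrite [X in measurable X](_ : _ = ~` [set x | rho + 2 * a < enorm x]).
    by apply: measurableC; exact: measurable_enorm_gt.
  by apply/seteqP; split => x /=; rewrite /near/= leNgt => /negP.
(* l x has norm at most rho - a, and l x is at distance at most 3 a of x *)
pose l := (rho - a) / (rho + 2 * a).
have l0 : 0 <= l by rewrite divr_ge0//; lra.
have l1 : (1 - l) * (rho + 2 * a) = 3 * a by rewrite /l; field; lra.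
have l2 : l * (rho + 2 * a) = rho - a by rewrite /l; field; lra.
have l3 : l <= 1 by rewrite ler_pdivrMr; lra.
pose Q : set (T * T) := [set z | cube (l *: z.1) t z.2].
have mQ : measurable Q by exact: measurable_shifted_cube_pair.
pose g z : R := \1_Q z.
have mg : measurable_fun setT g by exact: measurable_indic.
have g0 z : 0 <= g z by rewrite /g indicE.
pose q x := f x ^+ 2 * m x * \1_near x.
have near0 x : 0 <= (\1_near x : R) by rewrite indicE.
have q0 x : 0 <= q x by rewrite /q; nng.
have mq : measurable_fun setT q.
  by apply: measurable_funM; [exact: measurable_sqr_density|exact: measurable_indic].
pose v z := \1_near z.1 * g z.
have v01 z : 0 <= v z <= 1.
  by rewrite /v /g !indicE; do 2 case: (_ \in _); rewrite ?mulr1 ?mulr0 /= lexx ler01.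
have v0 z : 0 <= v z by case/andP: (v01 z).
have mv : measurable_fun setT v.
  apply: measurable_funM => //.
  by apply: (measurableT_comp (measurable_indic mnear)); exact: measurable_fst.
have vQ z : v z != 0 -> enorm z.1 <= rho + 2 * a /\ cube (l *: z.1) t z.2.
  rewrite /v /g !indicE; case: (boolP (_ \in _)) => [|_]; last by rewrite mul0r eqxx.
  rewrite inE => h1; case: (boolP (_ \in _)) => [|_]; last by rewrite mulr0 eqxx.
  by rewrite inE.
have v4a z : 4 * a < enorm (z.1 - z.2) -> v z = 0.
  move=> az; apply/eqP/negPn/negP => /vQ[z1 /(cube_enorm t0)]; rewrite -/a => z2.
  have h1 := ler_enormD (z.1 - l *: z.1) (l *: z.1 - z.2).
  rewrite addrA subrK in h1.
  have h2 : enorm (z.1 - l *: z.1) <= 3 * a.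
    rewrite -[X in X - _]scale1r -scalerBl enormZ ger0_norm ?subr_ge0// -l1.
    by rewrite ler_wpM2l// subr_ge0.
  rewrite enorm_distC in z2; lra.
have vH z : v z <= H * m z.2.
  have [->|/vQ[z1 /(cube_enorm t0)]] := eqVneq (v z) 0; first exact: mulr_ge0.
  rewrite -/a => z2.
  apply: (@le_trans _ _ 1); first by case/andP: (v01 z).
  apply: Hm; have h1 := ler_enormD (z.2 - l *: z.1) (l *: z.1).
  rewrite subrK enormZ ger0_norm// in h1.
  have h2 : l * enorm z.1 <= rho - a by rewrite -l2 ler_wpM2l.
  lra.
have D0 z : 0 <= sqgap z by exact: sqr_ge0.
pose k x := `|f x| * m x.
have k0 x : 0 <= k x by rewrite mulr_ge0.
have mk : measurable_fun setT k by apply: measurable_funM mm; exact: measurableT_comp mf.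
have mk1 : measurable_fun setT (fun z : T * T => k z.1).
  by apply: measurableT_comp mk _; exact: measurable_fst.
have mk2 : measurable_fun setT (fun z : T * T => k z.2).
  by apply: measurableT_comp mk _; exact: measurable_snd.
have mvD : measurable_fun setT (fun z => v z * sqgap z * m z.1).
  by apply: measurable_funM measurable_m1; apply: measurable_funM measurable_sqgap.
have vD0 z : 0 <= v z * sqgap z * m z.1 by nng.
rewrite integral_indicr.
have gE x : (\int[L]_y (g (x, y))%:E = ((2 * t) ^+ n)%:E)%E.
  rewrite (eq_integral (fun y => (\1_(cube (l *: x) t) y)%:E)).
    by rewrite integral_indic ?setIT; [exact: lebesgue_rV_cube| |exact: measurable_cube].
  by move=> y _; rewrite /g !indicE; congr (_%:R%:E); congr nat_of_bool; apply/idP/idP; rewrite !inE.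
apply: le_trans (iint_slice_ge (q := q) (g := g) _ mq q0 mg g0 _) _.
- by rewrite exprn_ge0// mulr_ge0// ltW.
- by move=> x; rewrite gE.
have kk0 z : 0 <= k z.1 * k z.2 by exact: mulr_ge0.
have mkk : measurable_fun setT (fun z : T * T => k z.1 * k z.2) by exact: measurable_funM.
have HH0 : 0 <= 2 * H by rewrite mulr_ge0.
apply: (@le_trans _ _ (iint (fun z => v z * sqgap z * m z.1 + 2 * H * (k z.1 * k z.2)))).
  apply: le_iint.
  - apply: measurable_funM => //.
    by apply: measurableT_comp mq _; exact: measurable_fst.
  - by apply: measurable_funD => //; apply: measurable_funM.
  - by move=> z; rewrite mulr_ge0.
  move=> z.
  rewrite (_ : q z.1 * g z = v z * f z.1 ^+ 2 * m z.1); last by rewrite /q /v; ring.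
  apply: (@le_trans _ _ (v z * (sqgap z + 2 * (`|f z.1| * `|f z.2|)) * m z.1)).
    rewrite ler_wpM2r// ler_wpM2l//.
    have := sqr_ge0 (f z.2); have : f z.1 * f z.2 <= `|f z.1| * `|f z.2| by rewrite -normrM ler_norm.
    by rewrite /sqgap; nra.
  rewrite mulrDr mulrDl lerD2l.
  rewrite (_ : v z * _ * _ = (2 * (k z.1 * `|f z.2|)) * v z); last by rewrite /k; ring.
  rewrite (_ : 2 * H * _ = (2 * (k z.1 * `|f z.2|)) * (H * m z.2)); last by rewrite /k; ring.
  by rewrite ler_wpM2l// mulr_ge0// mulr_ge0.
rewrite iintD//; last 2 first.
- by apply: measurable_funM.
- by move=> z; exact: mulr_ge0.
rewrite iintZ// [leRHS]EFinD; apply: leeD.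
  by apply: short_jumps_fin => //; rewrite mulr_ge0.
rewrite mulrA [leRHS]EFinM; apply: lee_wpmul2l => //.
rewrite EFinM -{2}NE.
apply: (iint_slice_le (q := k) (g := fun z => k z.2)) => // x.
by rewrite -NE.
Qed.

Definition kern_constant : R := (9 / 16) ^+ n.
(** Chosen so that the multiple 4 kappa 2^d of the total mass in [far_estimate]
    is half of [kern_constant], and can be absorbed in the left-hand side. *)
Definition mean_constant : R := kern_constant / (8 * 2 ^+ n).
Definition energy_constant : R :=
  2 / kern_constant * ((4 * mean_constant + 2) * Num.sqrt n%:R `^ p +
                      kern_constant / 2 ^+ n * (4 * Num.sqrt n%:R) `^ p).
Definition norm_constant : R := 4 / 2 ^+ n.

Lemma weighted_super_poincare (t rho H N : R) (a := Num.sqrt n%:R * t) :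
  0 < t -> 0 < rho -> a <= rho -> 0 <= H -> 0 <= N ->
  (forall y, rho + a < enorm y ->
    (\int[L]_(x in cube y t) (kern y t x * m x)%:E <=
    mean_constant%:E * \int[L]_(x in cube y t) (m x)%:E)%E) ->
  (forall x, enorm x <= rho -> 1 <= H * m x) -> mass1 = N%:E ->
  A <= energy_constant * t `^ alpha * E + norm_constant * t ^- n * H * N ^+ 2.
Proof.
move=> t0 rho0 arho H0 N0 hmean Hm NE.
have c0 : 0 < kern_constant by rewrite exprn_gt0// divr_gt0.
have k0 : 0 < mean_constant by rewrite divr_gt0// mulr_gt0// exprn_gt0.
have farE := far_estimate t0 (ltW k0) hmean.
have nearE := near_estimate t0 rho0 arho H0 N0 Hm NE.
rewrite -/a in farE nearE.
set far := [set x | (rho + 2 * a < enorm x)%R] in farE.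
set near := [set x | (enorm x <= rho + 2 * a)%R] in nearE.
have mfar : measurable far by exact: measurable_enorm_gt.
have nearC : near = ~` far.
  by apply/seteqP; split => x /=; rewrite /near /far/= leNgt => /negP.
have q0 x : 0 <= f x ^+ 2 * m x by nng.
have split : (\int[L]_(x in far) (f x ^+ 2 * m x)%:E + \int[L]_(x in near) (f x ^+ 2 * m x)%:E = A%:E)%E.
  rewrite nearC -ge0_integral_setU//.
  - by rewrite setUv.
  - exact: measurableC.
  - by rewrite setUv; apply/measurable_EFinP; exact: measurable_sqr_density.
  - by move=> x _; rewrite lee_fin.
  - exact/disj_setPCl.
have far_ge0 : (0 <= \int[L]_(x in far) (f x ^+ 2 * m x)%:E)%E by apply: integral_ge0 => x _; rewrite lee_fin.
have near_ge0 : (0 <= \int[L]_(x in near) (f x ^+ 2 * m x)%:E)%E by apply: integral_ge0 => x _; rewrite lee_fin.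
move: farE nearE split far_ge0 near_ge0.
case: (\int[L]_(x in far) _)%E => [X| |]//; case: (\int[L]_(x in near) _)%E => [Y| |]//.
rewrite -!EFinM -EFinD !lee_fin => farE nearE [XYA] X0 Y0.
have T0 : 0 < t ^+ n by rewrite exprn_gt0.
have B0 : 0 < 2 ^+ n :> R by rewrite exprn_gt0.
have tp : t `^ p = t ^+ n * t `^ alpha.
  rewrite powRD ?powR_mulrn ?ltW//.
  by apply/implyP => _; rewrite gt_eqF.
have ap : a `^ p = Num.sqrt n%:R `^ p * (t ^+ n * t `^ alpha).
  by rewrite /a powRM ?sqrtr_ge0 ?ltW// tp.
have ap4 : (4 * a) `^ p = (4 * Num.sqrt n%:R) `^ p * (t ^+ n * t `^ alpha).
  by rewrite /a mulrA powRM ?mulr_ge0 ?sqrtr_ge0 ?ltW// tp.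
move: farE nearE; rewrite -/kern_constant ap ap4 !exprMn /energy_constant /norm_constant -XYA expr2.
have kE : mean_constant * 2 ^+ n = kern_constant / 8.
  by rewrite /mean_constant; field; rewrite gt_eqF.
move: kE c0 k0 T0 B0.
move: (kern_constant) (mean_constant) (t ^+ n) (2 ^+ n) (t `^ alpha) (Num.sqrt _ `^ p)
  ((4 * Num.sqrt _) `^ p) => c k T B tau S1 S4 kE c0 k0 T0 B0 h1 h2.
have {}h1 : c * X <= c / 2 * (X + Y) + (4 * k + 2) * S1 * tau * E.
  rewrite -(ler_pM2l T0).
  rewrite (_ : T * (c * X) = c * T * X); last by ring.
  apply: le_trans h1 _; rewrite le_eqVlt; apply/orP; left; apply/eqP.
  rewrite (_ : 4 * k * (B * T) = 4 * (k * B) * T); last by ring.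
  by rewrite kE; field.
have {}h2 : Y <= S4 / B * tau * E + 2 / B * T^-1 * H * (N * N).
  rewrite -(ler_pM2l (mulr_gt0 B0 T0)).
  apply: le_trans h2 _; rewrite le_eqVlt; apply/orP; left; apply/eqP.
  by field; rewrite !gt_eqF.
rewrite -(ler_pM2l (divr_gt0 c0 (ltr0n R 2))).
have h3 : c * Y <= c * (S4 / B * tau * E + 2 / B * T^-1 * H * (N * N)) by rewrite ler_pM2l.
rewrite [leRHS](_ : _ = (4 * k + 2) * S1 * tau * E +
   c * (S4 / B * tau * E + 2 / B * T^-1 * H * (N * N))); last by field; rewrite !gt_eqF.
lra.
Qed.

End estimates.

(** * Transfer to the Gibbs measure *)

Section gibbs_density.
Context {R : realType} {n : nat}.
Local Notation T := 'rV[R]_n.+1.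
Local Notation L := (@lebesgue_rV R n.+1).

Lemma has_partial_partial (i : 'I_n.+1) (V : T -> R) :
  (forall x, derivable V x (delta_mx 0 i)) -> has_partial i V (partial i V).
Proof.
move=> dV w a.
have E : (fun h : R => h^-1 *: (V ((h *: (1 : R) + a) *: delta_mx 0 i + w)
                                - V (a *: delta_mx 0 i + w))) =
         (fun h : R => h^-1 *: (V (h *: delta_mx 0 i + (a *: delta_mx 0 i + w))
                                - V (a *: delta_mx 0 i + w))).
  by apply/funext => h; rewrite scalerDl addrA /GRing.scale/= mulr1.
have dVx := dV (a *: delta_mx 0 i + w).
apply: DeriveDef.
  rewrite /derivable/=.
  by move: dVx; rewrite /derivable/= -E.
by rewrite /partial /derive/= E.
Qed.

Lemma has_partial_density (i : 'I_n.+1) (V : T -> R) g :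
  has_partial i V g -> has_partial i (fun x => expR (- V x)) (fun x => - g x * expR (- V x)).
Proof.
move=> dV w a; have ? := dV w a.
apply: is_derive_eq.
by rewrite /GRing.scale/=; ring.
Qed.

(** The second derivative of exp (- V) in one direction; the sum over the
    directions is (|grad V|^2 - Lap V) exp (- V). *)
Lemma has_partial2_density (i : 'I_n.+1) (V : T -> R) g h :
  has_partial i V g -> has_partial i g h ->
  has_partial i (fun x => - g x * expR (- V x)) (fun x => (g x ^+ 2 - h x) * expR (- V x)).
Proof.
move=> dV dg w a; have ? := dV w a; have ? := dg w a.
apply: is_derive_eq.
by rewrite /GRing.scale/=; ring.
Qed.

Lemma Ck2_partials (V : T -> R) (i : 'I_n.+1) : Ck 2 V ->
  [/\ continuous V, has_partial i V (partial i V),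
      continuous (partial i V), has_partial i (partial i V) (partial i (partial i V)) &
      continuous (partial i (partial i V))].
Proof.
case=> cV /(_ i) [dV [c1 /(_ i) [d2 [c2 _]]]].
have pV := has_partial_partial dV; have p2 := has_partial_partial d2.
by split; [exact: cV|exact: pV|exact: c1|exact: p2|exact: c2].
Qed.

(** Lap m = (|grad V|^2 - Lap V) m >= s m on the cube, since delta <= 1. *)
Lemma gibbs_kern_mean (V : T -> R) (delta t s : R) y : Ck 2 V ->
  delta <= 1 -> 0 < t -> 0 < s ->
  (forall x, cube y t x -> s <= W_integrand delta V x) ->
  (\int[L]_(x in cube y t) (kern y t x * expR (- V x))%:E <=
   (8 * n.+1%:R / (s * t ^+ 2))%:E * \int[L]_(x in cube y t) (expR (- V x))%:E)%E.
Proof.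
move=> V2 d1 t0 s0 sW.
have cV : continuous V by case: (Ck2_partials ord0 V2).
have cm : continuous (fun x => expR (- V x)).
  move=> x; apply: (@continuous_comp _ _ _ (fun x => - V x) (@expR R)); last exact: continuous_expR.
  by apply: (@cvgN _ _ _ (nbhs x) _ V); exact: cV.
have key : (s%:E * \int[L]_(x in cube y t) (kern y t x * expR (- V x))%:E <=
   (8 * n.+1%:R / t ^+ 2)%:E * \int[L]_(x in cube y t) (expR (- V x))%:E)%E.
 apply: (@kern_mean R n (fun x => expR (- V x)) (fun i x => - partial i V x * expR (- V x))
  (fun i x => (partial i V x ^+ 2 - partial i (partial i V) x) * expR (- V x)) y t s t0 cm).
- move=> i x; have [_ _ c1 _ c2] := Ck2_partials i V2.
  apply: (@cvgM _ _ (nbhs x) _ (fun x => partial i V x ^+ 2 - partial i (partial i V) x)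
     (fun x => expR (- V x))); last exact: cm.
  apply: (@cvgB _ _ _ (nbhs x) _ (fun x => partial i V x ^+ 2)); last exact: c2.
  apply: (@continuous_comp _ _ _ (partial i V) (fun u : R => u ^+ 2)); first exact: c1.
  exact: exprn_continuous.
- by move=> i; have [_ d _ _ _] := Ck2_partials i V2; exact: has_partial_density.
- by move=> i; have [_ d _ d2 _] := Ck2_partials i V2; exact: has_partial2_density.
- by move=> x; exact: expR_ge0.
- move=> x qx; rewrite -mulr_suml ler_wpM2r ?expR_ge0// (le_trans (sW x qx))//.
  rewrite /W_integrand /laplacian sumrB lerD2r.
  rewrite (_ : enorm _ ^+ 2 = \sum_i partial i V x ^+ 2); last first.
    by rewrite enorm_sqr; apply: eq_bigr => i _; rewrite mxE.
  by rewrite ler_piMl// sumr_ge0// => i _; exact: sqr_ge0.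
rewrite (_ : 8 * _ / _ = s^-1 * (8 * n.+1%:R / t ^+ 2)); last by rewrite invfM; ring.
have sVK (I : \bar R) : (I = s^-1%:E * (s%:E * I))%E.
  by rewrite muleA -EFinM mulVf ?gt_eqF// mul1e.
rewrite [leLHS]sVK EFinM -muleA.
by apply: lee_wpmul2l => //; rewrite lee_fin invr_ge0 ltW.
Qed.

Lemma gibbs_integral (V : T -> R) (P : probability T R) (F : T -> \bar R) :
  continuous V -> gibbs V = P -> measurable_fun setT F -> (forall x, 0 <= F x)%E ->
  (\int[gibbs V]_x F x =
   (fine (\int[L]_y (expR (- V y))%:E))^-1%:E * \int[L]_x (F x * (expR (- V x))%:E))%E.
Proof.
move=> cV VP mF F0; rewrite VP.
set c := (fine _)^-1.
have c0 : 0 <= c by rewrite invr_ge0 fine_ge0// integral_ge0// => x _; rewrite lee_fin expR_ge0.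
have mm : measurable_fun setT (fun x => expR (- V x)).
  apply: measurableT_comp => //; apply: measurableT_comp => //.
  exact: measurable_continuous_rV.
have mmE : measurable_fun setT (fun x => (expR (- V x))%:E) by exact/measurable_EFinP.
rewrite (@ge0_integral_density R _ _ P L (fun x => c * expR (- V x)))//.
- rewrite -ge0_integralZl//.
  + by apply: eq_integral => x _; rewrite EFinM muleCA.
  + exact: emeasurable_funM.
  + by move=> x _; rewrite mule_ge0// lee_fin expR_ge0.
- exact: measurable_funM.
- by move=> x; rewrite mulr_ge0// expR_ge0.
- move=> A mA; transitivity (gibbs V A); first by rewrite VP.
  rewrite /gibbs -/c; under [RHS]eq_integral do rewrite EFinM.
  rewrite ge0_integralZl//.
  + exact: measurable_funTS.
Qed.

Lemma gibbs_constant_gt0 (V : T -> R) (P : probability T R) : gibbs V = P ->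
  0 < (fine (\int[L]_y (expR (- V y))%:E))^-1.
Proof.
move=> VP; rewrite lt_neqAle invr_ge0 fine_ge0 ?andbT; last first.
  by apply: integral_ge0 => x _; rewrite lee_fin expR_ge0.
apply/eqP => c0; have : P setT = 1%E by exact: probability_setT.
have -> : P setT = gibbs V setT by rewrite VP.
by rewrite /gibbs -c0 mul0e => /eqP; rewrite eq_sym onee_eq0.
Qed.

(** The factor Z, the integral of exp (- V), comes from the square of
    mu(|f|) = Z^-1 int |f| exp (- V) against the single Z^-1 in the other terms. *)
Lemma gibbs_super_poincare (alpha delta t rho H : R) (V : T -> R)
    (P : probability T R) (f : T -> R) :
  0 < alpha -> Ck 2 V -> gibbs V = P -> delta <= 1 ->
  0 < t -> 0 < rho -> Num.sqrt n.+1%:R * t <= rho ->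
  (forall x, rho < enorm x ->
     8 * n.+1%:R / @mean_constant R n.+1 / t ^+ 2 <= W_integrand delta V x) ->
  (forall x, enorm x <= rho -> expR (V x) <= H) ->
  dirichlet_domain alpha V f ->
  (\int[gibbs V]_x (f x ^+ 2)%:E <=
     (@energy_constant R n.+1 alpha * t `^ alpha)%:E * dirichlet_form alpha V f f +
     (@norm_constant R n.+1 * fine (\int[L]_y (expR (- V y))%:E) * t ^- n.+1 * H)%:E *
       (\int[gibbs V]_x `|f x|%:E) ^+ 2)%E.
Proof.
move=> alpha0 V2 VP d1 t0 rho0 trho sW VH [mf f2 Ef].
have cV : continuous V by case: (Ck2_partials ord0 V2).
have c0 := gibbs_constant_gt0 VP.
set Z := fine _; rewrite -/Z in c0.
have Z0 : 0 < Z by rewrite -invr_gt0.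
pose m x := expR (- V x).
have mm : measurable_fun setT m.
  apply: measurableT_comp => //; apply: measurableT_comp => //.
  exact: measurable_continuous_rV.
have m0 x : 0 <= m x by exact: expR_ge0.
have H0 : 0 <= H.
  by apply: le_trans (VH 0 _); [exact: expR_ge0|rewrite enorm0 ltW].
have EfE : dirichlet_form alpha V f f = (Z^-1%:E * jump_energy alpha f m)%E.
  pose g (z : T * T) : R := (f z.1 - f z.2) * (f z.1 - f z.2) / enorm (z.1 - z.2) `^ (n.+1%:R + alpha).
  have g0 z : 0 <= g z by rewrite /g divr_ge0 ?powR_ge0// -expr2 sqr_ge0.
  have mg : measurable_fun setT g.
    have := @measurable_jump_density R n.+1 alpha f (cst 1) mf (measurable_cst _).
    by rewrite /jump_density; under eq_fun do rewrite mulr1.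
  rewrite /dirichlet_form (gibbs_integral cV VP); last 2 first.
  - exact: (measurable_slice mg g0).
  - by move=> x; apply: integral_ge0 => y _; rewrite lee_fin; exact: (g0 (x, y)).
  congr (_ * _)%E; rewrite /jump_energy.
  rewrite (_ : jump_density _ _ _ = (fun z => m z.1 * g z)); last first.
    by apply/funext => z; rewrite /jump_density mulrC.
  rewrite iint_slice//.
  by apply: eq_integral => x _; rewrite muleC.
have f2E : (\int[gibbs V]_x (f x ^+ 2)%:E = Z^-1%:E * mass2 f m)%E.
  rewrite (gibbs_integral cV VP)//.
  - by apply/measurable_EFinP; exact: measurable_funX.
  - by move=> x; rewrite lee_fin sqr_ge0.
have f1E : (\int[gibbs V]_x `|f x|%:E = Z^-1%:E * mass1 f m)%E.
  rewrite (gibbs_integral cV VP)//.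
  - by apply/measurable_EFinP; exact: measurableT_comp.
have mass1_ge0 : (0 <= mass1 f m)%E by apply: integral_ge0 => x _; rewrite lee_fin mulr_ge0.
have mass2_ge0 : (0 <= mass2 f m)%E by apply: integral_ge0 => x _; rewrite lee_fin mulr_ge0// sqr_ge0.
have energy_ge0 : (0 <= jump_energy alpha f m)%E by apply: iint_ge0; exact: jump_density_ge0.
rewrite EfE f2E f1E in f2 Ef *.
have ltyE (I : \bar R) : (0 <= I -> Z^-1%:E * I < +oo -> exists r, I = r%:E)%E.
  case: I => [r| |]//; first by exists r.
  by rewrite gt0_muley ?lte_fin.
have [A AE] := ltyE _ mass2_ge0 f2.
have [E EE] := ltyE _ energy_ge0 Ef.
have Hgt0 : 0 < H.
  by apply: lt_le_trans (VH 0 _); [exact: expR_gt0|rewrite enorm0 ltW].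
have C20 : 0 < @norm_constant R n.+1 by rewrite divr_gt0// exprn_gt0.
have T0 : 0 < t ^+ n.+1 by rewrite exprn_gt0.
case NE : (mass1 f m) mass1_ge0 => [N| |]// N0; last first.
  rewrite gt0_muley ?lte_fin// expe2 mulyy gt0_muley; last first.
    by rewrite lte_fin !mulr_gt0// invr_gt0.
  by rewrite EE -!EFinM addey ?leey.
rewrite lee_fin in N0.
have k0 : 0 < @mean_constant R n.+1 by rewrite divr_gt0 ?mulr_gt0 ?exprn_gt0 ?divr_gt0.
have mean y : rho + Num.sqrt n.+1%:R * t < enorm y ->
  (\int[L]_(x in cube y t) (kern y t x * m x)%:E <=
   (@mean_constant R n.+1)%:E * \int[L]_(x in cube y t) (m x)%:E)%E.
  move=> yr.
  pose s := 8 * n.+1%:R / @mean_constant R n.+1 / t ^+ 2.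
  have s0 : 0 < s by rewrite !divr_gt0// ?mulr_gt0// exprn_gt0.
  have sE : @mean_constant R n.+1 = 8 * n.+1%:R / (s * t ^+ 2).
    by rewrite /s; field; rewrite !gt_eqF.
  rewrite sE; apply: (@gibbs_kern_mean V delta) => //.
  move=> x /(cube_enorm t0) xy; apply: sW.
  have := ler_enormD (y - x) x; rewrite subrK enorm_distC; lra.
have Hm x : enorm x <= rho -> 1 <= H * m x.
  by move=> /VH xH; rewrite /m expRN ler_pdivlMr ?expR_gt0// mul1r.
have := @weighted_super_poincare R n.+1 alpha f m alpha0 mf mm m0 A E AE EE t rho H N
  t0 rho0 trho H0 N0 mean Hm NE.
rewrite AE EE -!EFinM -EFinD lee_fin.
move: (energy_constant _) (norm_constant) => C1 C2 h.
rewrite -(ler_pM2l Z0) mulrA divff ?gt_eqF// mul1r (le_trans h)// le_eqVlt.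
apply/orP; left; apply/eqP; field; rewrite !gt_eqF//.
Qed.

End gibbs_density.

(** * The inequality for a general potential *)

Ltac pos := repeat first [done | by apply: powR_gt0 | by apply: exprn_gt0
  | by rewrite invr_gt0 exprn_gt0 | apply: mulr_gt0].

Section rate_functions.
Context {R : realType} {n : nat}.
Local Notation T := 'rV[R]_n.+1.
Local Notation L := (@lebesgue_rV R n.+1).
Implicit Types (V : T -> R) (delta s r : R).

Lemma enorm_delta : enorm (delta_mx 0 ord0 : T) = 1.
Proof.
rewrite /enorm (bigD1 ord0)//= big1 ?addr0; last first.
  by move=> i i0; rewrite mxE (negbTE i0) expr0n.
by rewrite mxE !eqxx expr1n sqrtr1.
Qed.

Lemma W_inv_set_nonempty V delta s :
  cvg_pinfty_at_infinity (W_integrand delta V) ->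
  exists r, 0 <= r /\ (s%:E <= W_fun delta V r)%E.
Proof.
move=> /(_ s)[K hK]; exists (`|K| + 1); split; first by rewrite addr_ge0.
apply: le_ereal_inf_tmp => _ [x /= xK <-]; rewrite lee_fin ltW// hK//.
by rewrite (lt_le_trans _ xK)// (le_lt_trans (ler_norm K))// ltrDl.
Qed.

(** A radius below 1 is excluded by the value of the integrand at a unit vector.
    This keeps rho away from 0, as the inner region needs sqrt d t <= rho. *)
Lemma W_inv_ge1 V delta s :
  cvg_pinfty_at_infinity (W_integrand delta V) ->
  W_integrand delta V (delta_mx 0 ord0) < s -> 1 <= W_inv delta V s.
Proof.
move=> cW Ws; apply: lb_le_inf.
  by have [r hr] := W_inv_set_nonempty s cW; exists r.
move=> r [r0 sr]; rewrite leNgt; apply/negP => r1.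
have : (s%:E <= (W_integrand delta V (delta_mx 0 ord0))%:E)%E.
  apply: le_trans sr _; apply: ereal_inf_lbound.
  by exists (delta_mx 0 ord0) => //=; rewrite enorm_delta ltW.
by rewrite lee_fin leNgt Ws.
Qed.

Lemma W_inv_lt V delta s x :
  cvg_pinfty_at_infinity (W_integrand delta V) ->
  W_inv delta V s < enorm x -> s <= W_integrand delta V x.
Proof.
move=> cW Wx.
have [|r [r0 sr] rx] := @inf_lt _ [set r | 0 <= r /\ (s%:E <= W_fun delta V r)%E] _ _ Wx.
  by have [r hr] := W_inv_set_nonempty s cW; exists r.
rewrite -lee_fin; apply: le_trans sr _.
by apply: ereal_inf_lbound; exists x => //=; exact: ltW.
Qed.

(** By compactness of the ball the supremum is over a bounded set. *)
Lemma H_up_ge V r x : continuous V -> enorm x <= r -> expR (V x) <= H_up V r.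
Proof.
move=> cV xr; apply: ub_le_sup; last by exists x.
have ce : continuous (fun x => expR (V x)).
  by move=> y; apply: (@continuous_comp _ _ _ V (@expR R)); [exact: cV|exact: continuous_expR].
have : compact [set expR (V x) | x in [set x : T | enorm x <= r]].
  by apply: continuous_compact; [exact: continuous_subspaceT|exact: compact_enorm_ball].
move/compact_bounded => [M [Mr h]]; exists (M + 1) => y hy.
by apply: le_trans (ler_norm y) _; apply: h => //; rewrite ltrDl.
Qed.

Lemma h_low_ge1 V r : 0 <= r -> (forall x, 0 <= V x) -> 1 <= h_low V r.
Proof.
move=> r0 V0; apply: lb_le_inf; first by exists (expR (V 0)), 0 => //=; rewrite enorm0.
by move=> _ [x _ <-]; rewrite -expR0 ler_expR.
Qed.

Lemma h_low_le V r : 0 <= r -> (forall x, 0 <= V x) -> h_low V r <= expR (V 0).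
Proof.
move=> r0 V0; apply: ge_inf; last by exists 0 => //=; rewrite enorm0.
by exists 0 => _ [x _ <-]; exact: expR_ge0.
Qed.

Lemma energy_constant_gt0 (alpha : R) : 0 < @energy_constant R n.+1 alpha.
Proof.
have f0 : 0 < @kern_constant R n.+1 by rewrite exprn_gt0// divr_gt0.
have k0 : 0 < @mean_constant R n.+1 by rewrite divr_gt0 ?mulr_gt0 ?exprn_gt0.
rewrite /energy_constant mulr_gt0 ?divr_gt0// ltr_pwDl//.
  by rewrite mulr_gt0 ?powR_gt0 ?sqrtr_gt0// addr_gt0// mulr_gt0.
by rewrite mulr_ge0 ?powR_ge0// divr_ge0 ?ltW// exprn_gt0.
Qed.

Lemma super_poincare_general (alpha delta : R) V (P : probability T R) :
  0 < alpha -> Ck 2 V -> gibbs V = P -> (forall x, 0 <= V x) -> delta < 1 ->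
  cvg_pinfty_at_infinity (W_integrand delta V) ->
  exists c1 c2 : R, [/\ 0 < c1, 0 < c2 &
       super_poincare alpha V (rate alpha delta V c1 c2)].
Proof.
move=> alpha0 V2 VP V0 d1 cW.
have cV : continuous V by case: (Ck2_partials ord0 V2).
pose C1 := @energy_constant R n.+1 alpha.
pose C2 := @norm_constant R n.+1.
pose M := 8 * n.+1%:R / @mean_constant R n.+1.
pose Z := fine (\int[L]_y (expR (- V y))%:E).
have Z0 : 0 < Z by rewrite -invr_gt0; exact: gibbs_constant_gt0 VP.
have k0 : 0 < @mean_constant R n.+1 by rewrite divr_gt0 ?mulr_gt0 ?exprn_gt0 ?divr_gt0.
have M0 : 0 < M by rewrite divr_gt0// mulr_gt0.
have C10 : 0 < C1 by exact: energy_constant_gt0.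
have C20 : 0 < C2 by rewrite divr_gt0// exprn_gt0.
pose rho t := W_inv delta V (M / t ^+ 2).
pose We := W_integrand delta V (delta_mx 0 ord0).
(* below t1 the step sqrt d t is at most 1 and M / t^2 exceeds We, so that the
   inverse of W at M / t^2 is at least 1 *)
pose t1 := (Num.sqrt n.+1%:R + `|We| / M + 1)^-1.
have t1V : 1 <= t1^-1 by rewrite invrK lerDr addr_ge0 ?sqrtr_ge0// divr_ge0// ltW.
have t10 : 0 < t1 by rewrite -invr_gt0 (lt_le_trans _ t1V).
have small t : 0 < t -> t <= t1 -> Num.sqrt n.+1%:R * t <= 1 /\ We < M / t ^+ 2.
  move=> t0 tt1; set X := _ + 1 in t1 t1V t10 tt1 *.
  have s0 := sqrtr_ge0 (n.+1%:R : R).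
  have W0 : 0 <= `|We| / M by rewrite divr_ge0// ltW.
  have X0 : 0 < X by rewrite /X; lra.
  have tX : t * X <= 1 by rewrite -ler_pdivlMr// mul1r.
  split.
    by apply: le_trans tX; rewrite mulrC ler_wpM2l// ?ltW// /X; lra.
  rewrite ltr_pdivlMr ?exprn_gt0//.
  have WM : We <= (X - 1) * M.
    by rewrite (le_trans (ler_norm We))// -ler_pdivrMr// /X; lra.
  have t2 : t ^+ 2 <= t.
    have t11 : t <= 1 by apply: le_trans tX; rewrite ler_peMr ?(ltW t0)// /X; lra.
    by rewrite expr2 ler_piMr// ltW.
  have t20 : 0 < t ^+ 2 by rewrite exprn_gt0.
  apply: (@le_lt_trans _ _ ((X - 1) * M * t ^+ 2)); first by rewrite ler_pM2r.
  rewrite mulrAC -[ltRHS]mul1r ltr_pM2r//.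
  apply: (@le_lt_trans _ _ ((X - 1) * t)); last by nra.
  by rewrite ler_wpM2l// /X; lra.
have spi t f : 0 < t -> t <= t1 -> dirichlet_domain alpha V f ->
  (\int[gibbs V]_x (f x ^+ 2)%:E <=
     (C1 * t `^ alpha)%:E * dirichlet_form alpha V f f +
     (C2 * Z * t ^- n.+1 * H_up V (rho t))%:E * (\int[gibbs V]_x `|f x|%:E) ^+ 2)%E.
  move=> t0 tt1 df; have [ta tW] := small t t0 tt1.
  have rho1 : 1 <= rho t by exact: W_inv_ge1.
  apply: (@gibbs_super_poincare R n alpha delta t (rho t) _ V P f) => //.
  - exact: ltW.
  - by rewrite (lt_le_trans _ rho1).
  - exact: le_trans rho1.
  - by move=> x; exact: W_inv_lt.
  - by move=> x; exact: H_up_ge.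
pose c2 := M * C1 `^ (2 / alpha).
pose B1 := C2 * Z * t1 ^- n.+1 * H_up V (rho t1).
pose D2 := 1 + n.+1%:R / 2 : R.
pose B2 := C2 * Z * C1 `^ (n.+1%:R / alpha) * expR (V 0) `^ D2.
have eV0 : 1 <= expR (V 0) by rewrite -expR0 ler_expR.
have eV0p := expR_gt0 (V 0).
have B20 : 0 < B2 by pos.
have B10 : 0 <= B1.
  rewrite ltW// /B1; pos.
  have [_ tW] := small t1 t10 (lexx _).
  apply: lt_le_trans (H_up_ge (x := 0) cV _); first exact: expR_gt0.
  by rewrite enorm0 (le_trans ler01)//; exact: W_inv_ge1.
exists (B1 + B2), c2; split; [by rewrite ltr_wpDl| by rewrite mulr_gt0// powR_gt0|].
move=> r f r0 df.
pose t := (r / C1) `^ alpha^-1.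
have rC0 : 0 < r / C1 by rewrite divr_gt0.
have t0 : 0 < t by rewrite powR_gt0.
have tr : C1 * t `^ alpha = r.
  rewrite /t -powRrM mulVf ?gt_eqF// powRr1 ?ltW// mulrC divfK// gt_eqF//.
have tpow (k : nat) : t ^- k = C1 `^ (k%:R / alpha) * r `^ (- (k%:R / alpha)).
  rewrite -powR_mulrn ?(ltW t0)// -powRN /t -powRrM powRM ?invr_ge0 ?(ltW r0) ?(ltW C10)//.
  rewrite -(powR_inv1 (ltW C10)) -powRrM mulrC.
  by congr (_ `^ _ * _ `^ _); ring.
have energy_ge0 : (0 <= dirichlet_form alpha V f f)%E.
  rewrite /dirichlet_form VP; apply: integral_ge0 => x _; apply: integral_ge0 => y _.
  by rewrite lee_fin divr_ge0 ?powR_ge0// -expr2 sqr_ge0.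
have N0 : (0 <= (\int[gibbs V]_x `|f x|%:E) ^+ 2)%E.
  by rewrite VP expe_ge0// integral_ge0// => x _; rewrite lee_fin.
have mono (r1 b : R) : r1 <= r -> b <= rate alpha delta V (B1 + B2) c2 r ->
    (r1%:E * dirichlet_form alpha V f f + b%:E * (\int[gibbs V]_x `|f x|%:E) ^+ 2 <=
     r%:E * dirichlet_form alpha V f f +
     (rate alpha delta V (B1 + B2) c2 r)%:E * (\int[gibbs V]_x `|f x|%:E) ^+ 2)%E.
  by move=> r1r bb; apply: leeD; apply: lee_wpmul2r.
(* for t1 < t the inequality at scale t1 is stronger in the energy term, and
   its constant B1 is part of c1 *)
have [tt1|t1t] := leP t t1; last first.
  apply: le_trans (spi t1 f t10 (lexx _) df) _; apply: mono.
    by rewrite -tr ler_pM2l// ge0_ler_powR ?nnegrE ?ltW.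
  rewrite /rate; apply: (@le_trans _ _ (B1 + B2)); first by rewrite lerDl ltW.
  rewrite ler_peMr ?(addr_ge0 B10 (ltW B20))// lerDl.
  by apply: mulr_ge0; [apply: mulr_ge0|]; exact: powR_ge0.
apply: le_trans (spi t f t0 tt1 df) _; apply: mono; first by rewrite tr.
have rhoE : rho t = W_inv delta V (c2 * r `^ (- (2 / alpha))).
  by rewrite /rho /c2 -mulrA -(tpow 2%N).
rewrite /rate -rhoE.
have [_ tW] := small t t0 tt1.
have rho0 : 0 <= rho t by rewrite (le_trans ler01)//; exact: W_inv_ge1.
have H1 : 1 <= H_up V (rho t).
  by rewrite (le_trans eV0)//; apply: H_up_ge => //; rewrite enorm0.
have h1 := h_low_ge1 rho0 V0; have hV := h_low_le rho0 V0.
rewrite -/D2; set H := H_up _ _ in H1 *; set h := h_low _ _ in h1 hV *.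
have HH : H <= H `^ (2 + n.+1%:R / 2).
  rewrite -[leLHS]powRr1 ?(le_trans ler01)// ler_powR//.
  by apply: (@le_trans _ _ 2); rewrite ?ler1n// lerDl divr_ge0.
have D20 : 0 <= D2 by rewrite addr_ge0// divr_ge0.
have hh : 1 <= expR (V 0) `^ D2 * h `^ (- D2).
  rewrite powRN ler_pdivlMr ?powR_gt0 ?(lt_le_trans ltr01)// mul1r.
  by rewrite ge0_ler_powR ?nnegrE ?expR_ge0// (le_trans ler01).
rewrite tpow.
apply: (@le_trans _ _ (B2 * (r `^ (- (n.+1%:R / alpha)) * H `^ (2 + n.+1%:R / 2) * h `^ (- D2)))); last first.
  apply: ler_pM; rewrite ?lerDr//; first exact: ltW.
  by apply: mulr_ge0; [apply: mulr_ge0|]; exact: powR_ge0.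
have aux (u c v y e w : R) : u * c * v * (y * e * w) = u * (c * y) * (e * (v * w)) by ring.
rewrite /B2 aux.
have CZ0 : 0 < C2 * Z by exact: mulr_gt0.
have rC : 0 <= C1 `^ (n.+1%:R / alpha) * r `^ (- (n.+1%:R / alpha)).
  by apply: mulr_ge0; exact: powR_ge0.
rewrite ler_wpM2l//; first by apply: mulr_ge0 => //; exact: ltW.
by apply: le_trans HH _; rewrite ler_peMr ?powR_ge0.
Qed.

End rate_functions.

(** * The potential (1 + |x|^2)^eps and its derivatives *)

Section power_potential.
Context {R : realType} {n : nat}.
Local Notation T := 'rV[R]_n.+1.
Local Notation L := (@lebesgue_rV R n.+1).

(** The square of the Japanese bracket of x. *)
Definition japanese (x : T) : R := 1 + enorm x ^+ 2.

Lemma japanese_ge1 x : 1 <= japanese x.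
Proof. by rewrite lerDl sqr_ge0. Qed.

Lemma japanese_gt0 x : 0 < japanese x.
Proof. exact: lt_le_trans (japanese_ge1 x). Qed.

Lemma has_partial_eq (i : 'I_n.+1) (f g : T -> R) : has_partial i f g ->
  (forall x, derivable f x (delta_mx 0 i)) /\ partial i f = g.
Proof.
move=> fg.
have E x : (fun h : R => h^-1 *: (f ((h *: (1 : R) + 0) *: delta_mx 0 i + x)
                                - f ((0 : R) *: delta_mx 0 i + x))) =
         (fun h : R => h^-1 *: (f (h *: delta_mx 0 i + x) - f x)).
  apply/funext => h; rewrite addr0 scale0r add0r.
  by rewrite (_ : h *: (1 : R) = h)// /GRing.scale/= mulr1.
split=> [x|].
  have := @ex_derive _ _ _ _ _ _ _ (fg x 0).
  by rewrite /derivable/= E.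
apply/funext => x; have := @derive_val _ _ _ _ _ _ _ (fg x 0).
by rewrite scale0r add0r /partial /derive/= E.
Qed.

Lemma has_partial_coord (i j : 'I_n.+1) :
  has_partial j (fun x : T => x 0 i) (fun=> (i == j)%:R).
Proof.
move=> w a; under eq_fun do rewrite !mxE eqxx/=.
by apply: is_derive_eq; rewrite /GRing.scale/=; ring.
Qed.

Lemma has_partial_japanese (j : 'I_n.+1) :
  has_partial j japanese (fun x => 2 * x 0 j).
Proof.
move=> w a.
have E : (fun b : R => japanese (b *: delta_mx 0 j + w)) =
   (fun b : R => (b + w 0 j) ^+ 2 + (1 + \sum_(i | i != j) w 0 i ^+ 2)).
  apply/funext => b; rewrite /japanese enorm_sqr (bigD1 j)//= !mxE !eqxx/= mulr1.
  rewrite addrCA; congr (_ + (_ + _)); apply: eq_bigr => i ij.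
  by rewrite !mxE (negbTE ij) andbF mulr0 add0r.
rewrite E; apply: is_derive_eq.
by rewrite !mxE !eqxx /GRing.scale/= !mulr1; ring.
Qed.

Lemma has_partial_powR (j : 'I_n.+1) (p : R) :
  has_partial j (fun x => japanese x `^ p)
    (fun x => 2 * p * x 0 j * japanese x `^ (p - 1)).
Proof.
move=> w a; set x := a *: _ + w.
have dq := has_partial_japanese j w a; rewrite -/x in dq.
have dp := is_derive1_powR p (japanese_gt0 x).
have := @is_derive1_comp _ (fun u : R => u `^ p) (fun b : R => japanese (b *: delta_mx 0 j + w)) a _ _ dp dq.
by move=> h; apply: is_derive_eq; rewrite /GRing.scale/=; ring.
Qed.

Lemma has_partialM (j : 'I_n.+1) (f g f' g' : T -> R) :
  has_partial j f f' -> has_partial j g g' ->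
  has_partial j (fun x => f x * g x) (fun x => f x * g' x + g x * f' x).
Proof.
move=> df dg w a; have ? := df w a; have ? := dg w a.
by apply: is_derive_eq; rewrite /GRing.scale/=; ring.
Qed.

Lemma has_partialZ (j : 'I_n.+1) (c : R) (f f' : T -> R) :
  has_partial j f f' -> has_partial j (fun x => c * f x) (fun x => c * f' x).
Proof.
move=> df w a; have ? := df w a.
by apply: is_derive_eq; rewrite /GRing.scale/=; ring.
Qed.

Lemma continuous_japanese : continuous japanese.
Proof.
rewrite /japanese => x.
apply: (@cvgD _ _ _ (nbhs x) _ (fun=> 1 : R) (fun x : T => enorm x ^+ 2)); first exact: cvg_cst.
apply: (@continuous_comp _ _ _ (@enorm R n.+1) (fun u : R => u ^+ 2)).
  exact: continuous_enorm.
exact: exprn_continuous.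
Qed.

Lemma continuous_japanese_powR (p : R) : continuous (fun x => japanese x `^ p).
Proof.
move=> x; apply: (@continuous_comp _ _ _ japanese (fun u : R => u `^ p)).
  exact: continuous_japanese.
apply: differentiable_continuous; apply/derivable1_diffP.
by apply: ex_derive; exact: is_derive1_powR (japanese_gt0 x).
Qed.

Lemma continuous_coord (i : 'I_n.+1) : continuous (fun x : T => x 0 i).
Proof. exact: coord_continuous. Qed.

Variable eps : R.

Definition power_potential (x : T) : R := japanese x `^ eps.

Definition power_grad (i : 'I_n.+1) (x : T) : R :=
  2 * eps * (x 0 i * japanese x `^ (eps - 1)).

Definition power_hess (i j : 'I_n.+1) (x : T) : R :=
  2 * eps * (x 0 i * (2 * (eps - 1) * x 0 j * japanese x `^ (eps - 1 - 1)) +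
     japanese x `^ (eps - 1) * (i == j)%:R).

Lemma partial_power i : (forall x, derivable power_potential x (delta_mx 0 i)) /\
  partial i power_potential = power_grad i.
Proof.
apply: has_partial_eq => w a.
have h := has_partial_powR i eps w a.
by apply: is_derive_eq; rewrite /power_grad; ring.
Qed.

Lemma partial2_power i j : (forall x, derivable (power_grad i) x (delta_mx 0 j)) /\
  partial j (power_grad i) = power_hess i j.
Proof.
apply: has_partial_eq; apply: has_partialZ; apply: has_partialM.
  exact: has_partial_coord.
exact: has_partial_powR.
Qed.

Lemma Ck2_power : Ck 2 power_potential.
Proof.
have cM (f g : T -> R) : continuous f -> continuous g -> continuous (fun x => f x * g x).
  by move=> cf cg x; apply: (@cvgM _ _ (nbhs x) _ f g); [exact: cf|exact: cg].
have cD (f g : T -> R) : continuous f -> continuous g -> continuous (fun x => f x + g x).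
  by move=> cf cg x; apply: (@cvgD _ _ _ (nbhs x) _ f g); [exact: cf|exact: cg].
split; first exact: continuous_japanese_powR.
move=> i; have [d1 ->] := partial_power i; split; first exact: d1.
split.
  apply: (cM (fun=> 2 * eps)); first exact: cst_continuous.
  by apply: (cM); [exact: continuous_coord|exact: continuous_japanese_powR].
move=> j; have [d2 ->] := partial2_power i j; split=> //; split=> //.
apply: (cM (fun=> 2 * eps)); first exact: cst_continuous.
apply: (cD).
  apply: (cM); first exact: continuous_coord.
  apply: (cM); last exact: continuous_japanese_powR.
  apply: (cM (fun=> 2 * (eps - 1))); first exact: cst_continuous.
  exact: continuous_coord.
apply: (cM); first exact: continuous_japanese_powR.
exact: cst_continuous.
Qed.

End power_potential.

(** * Growth of the power potential *)

Section power_rate.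
Context {R : realType} {n : nat}.
Local Notation T := 'rV[R]_n.+1.
Local Notation L := (@lebesgue_rV R n.+1).
Variable eps : R.
Hypothesis eps12 : 1 / 2 < eps.
Local Notation V := (@power_potential R n eps).
Local Notation q := (@japanese R n).

Let eps0 : 0 < eps. Proof. by apply: lt_trans eps12. Qed.
Let eps21 : 0 < 2 * eps - 1. Proof. by have := eps12; lra. Qed.

(** From this value of 1 + |x|^2 on, the leading term of the integrand is at
    least twice the lower-order ones. *)
Definition power_threshold : R :=
  4 + (2 * (2 * eps * n.+1%:R + 4 * eps ^+ 2) / eps ^+ 2) ^+ 2.

(** With q = 1 + |x|^2 and u = q^(eps - 1), the gradient term is
    2 eps^2 (q - 1) u^2 and the Laplacian is at most K u; the first dominates
    since u q = q^eps >= sqrt q is large. *)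
Lemma W_power_ge x : power_threshold <= q x ->
  eps ^+ 2 * q x `^ (2 * eps - 1) <= W_integrand (1 / 2) V x.
Proof.
move=> qx; have q0 := japanese_gt0 x.
pose u := q x `^ (eps - 1).
have u0 : 0 < u by exact: powR_gt0.
have u2 : q x `^ (2 * eps - 1) = u ^+ 2 * q x.
  rewrite -[X in _ = _ * X]powRr1 ?ltW// /u -powR_mulrn ?powR_ge0// -powRrM -powRD.
    by congr (_ `^ _); ring.
  by apply/implyP => _; rewrite gt_eqF.
have uq : q x `^ (eps - 1 - 1) = u / q x.
  rewrite -[X in _ / X]powRr1 ?ltW// -powRN /u -powRD.
    by congr (_ `^ _).
  by apply/implyP => _; rewrite gt_eqF.
have gE : enorm (grad V x) ^+ 2 = 4 * eps ^+ 2 * (q x - 1) * u ^+ 2.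
  rewrite enorm_sqr.
  rewrite (eq_bigr (fun i => 4 * eps ^+ 2 * u ^+ 2 * x 0 i ^+ 2)); last first.
    by move=> i _; rewrite mxE (partial_power eps i).2 /power_grad -/u; ring.
  by rewrite -mulr_sumr -enorm_sqr /japanese; ring.
have lE : laplacian V x = 2 * eps * n.+1%:R * u + 4 * eps * (eps - 1) * (q x - 1) * u / q x.
  rewrite /laplacian.
  rewrite (eq_bigr (fun i => 4 * eps * (eps - 1) * u / q x * x 0 i ^+ 2 + 2 * eps * u)); last first.
    move=> i _; rewrite (partial_power eps i).2 (partial2_power eps i i).2 /power_hess -/u uq eqxx.
    by rewrite mulr1n; ring.
  rewrite big_split/= -mulr_sumr -enorm_sqr sumr_const card_ord /japanese.
  by rewrite -mulr_natl; field; rewrite gt_eqF//; exact: japanese_gt0.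
rewrite /W_integrand gE lE u2.
pose K := 2 * eps * n.+1%:R + 4 * eps ^+ 2.
have K0 : 0 < K by rewrite addr_gt0// !mulr_gt0// exprn_gt0.
have q4 : 4 <= q x by apply: le_trans qx; rewrite lerDl sqr_ge0.
have sq : 2 * K / eps ^+ 2 <= Num.sqrt (q x).
  rewrite -[leLHS]ger0_norm; last by rewrite divr_ge0 ?sqr_ge0// mulr_ge0// ltW.
  by rewrite -sqrtr_sqr ler_wsqrtr// (le_trans _ qx)// /power_threshold lerDr.
have uqe : Num.sqrt (q x) <= u * q x.
  rewrite -powR12_sqrt ?(ltW q0)// /u -[X in _ * X]powRr1 ?(ltW q0)// -powRD.
    apply: ler_powR; first exact: japanese_ge1.
    by have := eps12; lra.
  by apply/implyP => _; rewrite gt_eqF.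
have main : 2 * K <= eps ^+ 2 * (u * q x).
  by rewrite -ler_pdivrMl ?exprn_gt0// mulrC (le_trans sq).
have lap : 4 * eps * (eps - 1) * (q x - 1) * u / q x <= 4 * eps ^+ 2 * u.
  rewrite ler_pdivrMr//.
  have e2 : 0 <= eps ^+ 2 by exact: sqr_ge0.
  have eu : 0 <= eps * u by rewrite mulr_ge0// ltW.
  have equ : 0 <= eps * u * (q x - 1) by rewrite mulr_ge0//; lra.
  have e2u : 0 <= eps ^+ 2 * u by rewrite mulr_ge0// ltW.
  rewrite -subr_ge0 (_ : _ - _ = 4 * (eps * u * (q x - 1)) + 4 * (eps ^+ 2 * u)); last by ring.
  by rewrite addr_ge0// mulr_ge0.
have KE : 2 * eps * n.+1%:R * u + 4 * eps ^+ 2 * u = K * u by rewrite /K; ring.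
(* 2 K <= eps^2 u q, and q <= 2 (q - 2) *)
have m2 : K * u <= eps ^+ 2 * u ^+ 2 * (q x - 2).
  have : 2 * K * u <= eps ^+ 2 * (u * q x) * u by rewrite ler_pM2r.
  have : 0 <= eps ^+ 2 * u ^+ 2 * (q x - 4).
    by rewrite mulr_ge0 ?subr_ge0// mulr_ge0// sqr_ge0.
  nra.
have {lap KE m2} : 2 * eps * n.+1%:R * u + 4 * eps * (eps - 1) * (q x - 1) * u / q x <=
  eps ^+ 2 * u ^+ 2 * (q x - 2).
  by apply: le_trans m2; rewrite -KE lerD2l.
nra.
Qed.

(** The radius at which eps^2 q^(2 eps - 1) reaches s, enlarged so that
    [power_threshold] is passed. *)
Definition power_radius (s : R) : R :=
  Num.sqrt (power_threshold + (s / eps ^+ 2) `^ (2 * eps - 1)^-1).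

Lemma power_threshold_ge0 : 0 <= power_threshold.
Proof. by apply: addr_ge0 => //; exact: sqr_ge0. Qed.

Lemma power_radius_sqr s :
  power_radius s ^+ 2 = power_threshold + (s / eps ^+ 2) `^ (2 * eps - 1)^-1.
Proof.
by rewrite sqr_sqrtr// addr_ge0 ?powR_ge0 ?power_threshold_ge0.
Qed.

Lemma W_power_radius s x : 0 <= s -> power_radius s <= enorm x ->
  s <= W_integrand (1 / 2) V x.
Proof.
move=> s0 xs.
have x2 : power_radius s ^+ 2 <= enorm x ^+ 2.
  by rewrite lerXn2r ?nnegrE ?enorm_ge0 ?sqrtr_ge0.
rewrite power_radius_sqr in x2.
have th0 := power_threshold_ge0.
have v0 := powR_ge0 (s / eps ^+ 2) (2 * eps - 1)^-1.
have qx : power_threshold <= q x by rewrite /japanese; lra.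
apply: le_trans (W_power_ge qx).
have vq : (s / eps ^+ 2) `^ (2 * eps - 1)^-1 <= q x by rewrite /japanese; lra.
rewrite -ler_pdivrMl ?exprn_gt0// mulrC.
have se0 : 0 <= s / eps ^+ 2 by rewrite divr_ge0// sqr_ge0.
have sE : ((s / eps ^+ 2) `^ (2 * eps - 1)^-1) `^ (2 * eps - 1) = s / eps ^+ 2.
  by rewrite -powRrM mulVf ?gt_eqF// powRr1.
rewrite -[leLHS]sE.
by apply: ge0_ler_powR; rewrite ?nnegrE ?powR_ge0 ?(ltW eps21) ?(ltW (japanese_gt0 x)).
Qed.

Lemma cvg_W_power : cvg_pinfty_at_infinity (W_integrand (1 / 2) V).
Proof.
move=> M; exists (power_radius (`|M| + 1)) => x /ltW hx.
have := W_power_radius (_ : 0 <= `|M| + 1) hx.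
by move=> /(_ (addr_ge0 (normr_ge0 _) ler01)); have := ler_norm M; lra.
Qed.

Lemma W_inv_power_le s : 0 <= s -> 0 <= W_inv (1 / 2) V s <= power_radius s.
Proof.
move=> s0; apply/andP; split.
  apply: lb_le_inf; last by move=> r [].
  by have [r hr] := W_inv_set_nonempty s cvg_W_power; exists r.
apply: ge_inf; first by exists 0 => r [].
split; first exact: sqrtr_ge0.
by apply: le_ereal_inf_tmp => _ [x /= xs <-]; rewrite lee_fin W_power_radius.
Qed.

Lemma power_potential_ge0 x : 0 <= V x. Proof. exact: powR_ge0. Qed.

Lemma H_up_power_le (r rho : R) : 0 <= r -> r <= rho ->
  H_up V r <= expR ((1 + rho ^+ 2) `^ eps).
Proof.
move=> r0 rrho; apply: ge_sup.
  by exists (expR (V 0)), 0 => //=; rewrite enorm0.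
move=> _ [x /= xr <-]; rewrite ler_expR.
apply: ge0_ler_powR; rewrite ?nnegrE ?(ltW (japanese_gt0 x)) ?(ltW eps0)//.
  by rewrite addr_ge0// sqr_ge0.
rewrite lerD2l lerXn2r ?nnegrE ?enorm_ge0 ?(le_trans xr)//.
exact: le_trans rrho.
Qed.

End power_rate.

(** * The super Poincare inequality for the power potential *)

Section power_final.
Context {R : realType} {n : nat}.
Local Notation T := 'rV[R]_n.+1.
Local Notation L := (@lebesgue_rV R n.+1).
Variable eps : R.
Hypothesis eps12 : 1 / 2 < eps.
Local Notation V := (@power_potential R n eps).

Let eps0 : 0 < eps. Proof. by apply: lt_trans eps12. Qed.
Let eps21 : 0 < 2 * eps - 1. Proof. by have := eps12; lra. Qed.

Lemma powR_1D_le (v : R) : 0 <= v -> (1 + v) `^ eps <= 2 `^ eps * (1 + v `^ eps).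
Proof.
move=> v0; have v1 : 1 + v <= 2 * Num.max 1 v.
  by case: (leP 1 v) => h; lra.
have m0 : 0 <= Num.max 1 v by rewrite le_max ler01.
apply: (@le_trans _ _ ((2 * Num.max 1 v) `^ eps)).
  apply: ge0_ler_powR => //; rewrite ?nnegrE ?(ltW eps0)//.
    by rewrite addr_ge0.
  by rewrite mulr_ge0.
rewrite powRM// ler_wpM2l ?powR_ge0//.
case: (leP 1 v) => _; first by rewrite lerDr.
by rewrite powR1 lerDl powR_ge0.
Qed.

(** With y = r^(-g): log H is at most K1 (1 + y), the power of r in front is
    y^pp <= exp (pp y), and the power of h is at most 1. *)
Lemma rate_power_le (alpha c1 c2 : R) : 0 < alpha -> 0 < c1 -> 0 < c2 ->
  exists2 c : R, 0 < c & forall r, 0 < r ->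
    rate alpha (1 / 2) V c1 c2 r <=
    expR (c * (1 + r `^ (- (2 * eps / (alpha * (2 * eps - 1)))))).
Proof.
move=> alpha0 c10 c20.
pose g : R := 2 * eps / (alpha * (2 * eps - 1)).
have g0 : 0 < g by rewrite divr_gt0 ?mulr_gt0.
pose D1 : R := 2 + n.+1%:R / 2.
pose D2 : R := 1 + n.+1%:R / 2.
have D10 : 0 <= D1 by rewrite addr_ge0// divr_ge0.
have D20 : 0 <= D2 by rewrite addr_ge0// divr_ge0.
pose K2 := (c2 / eps ^+ 2) `^ (eps / (2 * eps - 1)).
pose th := @power_threshold R n eps.
have th0 : 0 <= th by exact: power_threshold_ge0.
pose K1 := (1 + th) `^ eps * (2 `^ eps * (1 + K2)).
pose pp := n.+1%:R / alpha / g.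
have pp0 : 0 <= pp by apply: divr_ge0; [apply: divr_ge0 => //|]; exact: ltW.
have K20 : 0 <= K2 by exact: powR_ge0.
have K10 : 0 <= K1.
  apply: mulr_ge0; first exact: powR_ge0.
  by apply: mulr_ge0; [exact: powR_ge0|exact: addr_ge0].
exists (c1 + 1 + pp + D1 * K1).
  have DK := mulr_ge0 D10 K10.
  by apply: ltr_wpDr => //; apply: ltr_wpDr => //; exact: addr_gt0.
move=> r r0; rewrite -/g; set y := r `^ (- g).
have y0 : 0 < y by exact: powR_gt0.
pose s := c2 * r `^ (- (2 / alpha)).
have s0 : 0 <= s by rewrite mulr_ge0 ?powR_ge0 ?ltW.
rewrite /rate -/s -/D1 -/D2.
have /andP[W0 WR] := @W_inv_power_le R n eps eps12 s s0.
set rho := W_inv _ _ _ in W0 WR *.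
have Hle : H_up V rho <= expR (K1 * (1 + y)).
  apply: le_trans (H_up_power_le eps12 W0 WR) _; rewrite ler_expR power_radius_sqr -/th.
  set v := (s / eps ^+ 2) `^ _.
  have v0 : 0 <= v by exact: powR_ge0.
  have ve : v `^ eps = K2 * y.
    have ce0 : 0 <= c2 / eps ^+ 2 by apply: divr_ge0; [exact: ltW|exact: sqr_ge0].
    rewrite [LHS](_ : _ = (c2 / eps ^+ 2) `^ ((2 * eps - 1)^-1 * eps) * (r `^ (- (2 / alpha))) `^ ((2 * eps - 1)^-1 * eps)); last by rewrite /v -[LHS]powRrM /s mulrAC [LHS]powRM ?powR_ge0.
    rewrite /K2 /y.
    rewrite -powRrM; congr (_ `^ _ * _ `^ _); first by rewrite mulrC.
    by rewrite /g; field; rewrite !gt_eqF.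
  apply: (@le_trans _ _ (((1 + th) * (1 + v)) `^ eps)).
    apply: ge0_ler_powR; rewrite ?nnegrE ?(ltW eps0)//.
    - by apply: addr_ge0 => //; apply: addr_ge0.
    - by apply: mulr_ge0; apply: addr_ge0.
    - by have := mulr_ge0 th0 v0; lra.
  rewrite [leLHS]powRM; [|exact: addr_ge0|exact: addr_ge0].
  rewrite /K1 -[leRHS]mulrA; apply: ler_wpM2l; first exact: powR_ge0.
  apply: le_trans (powR_1D_le v0) _; rewrite ve -mulrA ler_wpM2l ?powR_ge0//.
  by rewrite mulrDl !mulrDr !mulr1 mul1r; have := ltW y0; lra.
have H0 : 0 <= H_up V rho.
  have cV : continuous V by exact: continuous_japanese_powR.
  apply: le_trans (H_up_ge (x := 0) cV _); first exact: expR_ge0.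
  by rewrite enorm0.
have HD : H_up V rho `^ D1 <= expR (D1 * K1 * (1 + y)).
  rewrite -mulrA [X in expR X]mulrC expRM.
  by apply: ge0_ler_powR; rewrite ?nnegrE ?expR_ge0.
have h1 : h_low V rho `^ (- D2) <= 1.
  have h1 := h_low_ge1 W0 (@power_potential_ge0 R n eps).
  rewrite powRN invf_le1 ?powR_gt0 ?(lt_le_trans ltr01)//.
  by rewrite -[leLHS](powRr0 (h_low V rho)) ler_powR.
have rd : r `^ (- (n.+1%:R / alpha)) <= expR (pp * y).
  have -> : r `^ (- (n.+1%:R / alpha)) = y `^ pp.
    rewrite /y -powRrM /pp; congr (_ `^ _); field.
    by rewrite !gt_eqF.
  rewrite /powR gt_eqF// ler_expR ler_wpM2l//.
  by rewrite ltW// ln_sublinear.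
set a := r `^ _ in rd *; set b := _ `^ D1 in HD *; set e := _ `^ (- D2) in h1 *.
have a0 : 0 <= a by exact: powR_ge0.
have b0 : 0 <= b by exact: powR_ge0.
have e0 : 0 <= e by exact: powR_ge0.
have abe : a * b * e <= expR (pp * y + D1 * K1 * (1 + y)).
  rewrite expRD -[leRHS]mulr1; apply: ler_pM => //; first exact: mulr_ge0.
  exact: ler_pM.
set X := pp * y + D1 * K1 * (1 + y) in abe.
have X0 : 0 <= X.
  have := ltW y0; rewrite /X => y0'.
  apply: addr_ge0; first exact: mulr_ge0.
  by apply: mulr_ge0; [exact: mulr_ge0|exact: addr_ge0].
apply: (@le_trans _ _ (expR c1 * expR (1 + X))).
  apply: ler_pM; [exact: ltW|by apply: addr_ge0 => //; apply: mulr_ge0 => //; exact: mulr_ge0| |].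
    by have := expR_ge1Dx c1; lra.
  rewrite expRD.
  have e1 : 2 <= expR 1 :> R by have := expR_ge1Dx (1 : R); lra.
  have eX : 1 <= expR X by rewrite -expR0 ler_expR.
  nra.
rewrite -expRD ler_expR /X.
have := ltW y0 => y0'.
have : 0 <= c1 * y by rewrite mulr_ge0// ltW.
nra.
Qed.

Lemma super_poincare_le (alpha : R) (U : T -> R) (b1 b2 : R -> R) :
  (forall r, 0 < r -> b1 r <= b2 r) ->
  super_poincare alpha U b1 -> super_poincare alpha U b2.
Proof.
move=> b12 h r f r0 df; apply: le_trans (h r f r0 df) _.
rewrite leeD2l//; apply: lee_wpmul2r; last by rewrite lee_fin b12.
by rewrite expe2; case: (\int[_]_x _)%E => [z| |]//; rewrite -EFinM lee_fin -expr2 sqr_ge0.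
Qed.

(** When exp (- U) has infinite integral, the Gibbs measure is the null measure
    by convention and every super Poincare inequality for it reads 0 <= 0. *)
Lemma gibbs_null_or_probability (U : T -> R) : measurable_fun setT U ->
  gibbs U = mzero \/ exists P : probability T R, gibbs U = P.
Proof.
move=> mU; have [Z0|Z0] := eqVneq (fine (\int[L]_y (expR (- U y))%:E)) 0.
  by left; apply/funext => A; rewrite /gibbs Z0 invr0 mul0e.
right; apply: gibbs_probability => //.
rewrite /gibbs; move: Z0; case: (\int[L]_y _)%E => [z| |]/=; rewrite ?eqxx// => z0.
by rewrite -EFinM mulVf.
Qed.

Lemma super_poincare_power (alpha : R) : 0 < alpha ->
  exists c : R, 0 < c /\
       super_poincare alpha V
         (fun r => expR (c * (1 + r `^ (- (2 * eps / (alpha * (2 * eps - 1))))))).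
Proof.
move=> alpha0.
have mV : measurable_fun setT V.
  by apply: measurable_continuous_rV; exact: continuous_japanese_powR.
have [g0|[P VP]] := gibbs_null_or_probability mV.
  exists 1; split => // r f r0 _.
  rewrite /dirichlet_form g0 !integral_measure_zero mule0 add0e expe2 !mule0//.
have d1 : 1 / 2 < 1 :> R by lra.
have [c1 [c2 [c10 c20 spi]]] := super_poincare_general alpha0 (@Ck2_power R n eps) VP
  (@power_potential_ge0 R n eps) d1 (cvg_W_power eps12).
have [c c0 rc] := rate_power_le alpha0 c10 c20.
by exists c; split => //; exact: super_poincare_le spi.
Qed.

End power_final.

Unset Implicit Arguments.

Theorem theorem5p1 (R : realType) (d : nat) (alpha : R) :
  (0 < d)%N -> 0 < alpha < 2 ->
  (forall (V : 'rV[R]_d -> R) (delta : R),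
     Ck 2 V ->
     (exists P : probability 'rV[R]_d R, gibbs V = P) ->
     (forall x, 0 <= V x) ->
     0 < delta < 1 ->
     cvg_pinfty_at_infinity (W_integrand delta V) ->
     exists c1 c2 : R, [/\ 0 < c1, 0 < c2 &
       super_poincare alpha V (rate alpha delta V c1 c2)])
  /\
  (forall eps : R, 1 / 2 < eps ->
     exists c : R, 0 < c /\
       super_poincare alpha (fun x : 'rV[R]_d => (1 + enorm x ^+ 2) `^ eps)
         (fun r => expR (c * (1 + r `^ (- (2 * eps / (alpha * (2 * eps - 1)))))))).
Proof.
case: d => [//|n] _ /andP[alpha0 _]; split.
  move=> V delta V2 [P VP] V0 /andP[_ d1] cW.
  exact: (super_poincare_general alpha0 V2 VP V0 d1 cW).
by move=> eps eps12; exact: (super_poincare_power eps12 alpha0).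
Qed.
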